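(* Let $r\in[0,1]$, let $\alpha:(a,b)\to\mathbb{R}$ be strictly increasing, let $\beta\in \mathrm{BV}_{\rm loc}((a,b),\mathbb{R})$, and assume $\theta_{1-r}(x)\neq0$ and $\theta_{r}(x)\neq0$ for all $x\in(a,b)$. Let $u$ and $v$ be linearly independent real-valued $r$-balanced solutions of $-d(dy/d\alpha)+y\,d\beta=0$ on $(a,b)$. Let $s<t$ be consecutive points in $\mathcal{Z}_{(a,b)}(u)$ such that $\theta>0$ on $(s,t)$. Then: (1) If $u^+(s)=u^-(t)=0$, then $v$ changes sign in $(s,t)$. (2) If $u^-(s)=u^-(t)=0$ and $\theta_{r}(s)>0$, then $v$ changes sign in $[s,t)$. (3) If $u^+(s)=u^+(t)=0$ and $\theta_{1-r}(t)>0$, then $v$ changes sign in $(s,t]$. (4) If $u^-(s)=u^+(t)=0$ and $\theta_{r}(s)\theta_{1-r}(t)>0$, then $v$ changes sign in $[s,t]$.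
   Context: Throughout $-\infty\le a<b\le\infty$. $\mathrm{BV}_{\rm loc}((a,b),\mathbb{C})$ (resp. $\mathrm{BV}_{\rm loc}((a,b),\mathbb{R})$) is the space of complex-valued (resp. real-valued) functions of locally bounded variation on $(a,b)$. For such $f$: $f^-(x)=\lim_{t\uparrow x}f(t)$, $f^+(x)=\lim_{t\downarrow x}f(t)$; $df$ is the locally finite complex Borel measure on $(a,b)$ generated by $f$ (so $df([x,y))=f^-(y)-f^-(x)$ for $x<y$ in $(a,b)$); $\Delta_{df}(x)=df(\{x\})=f^+(x)-f^-(x)$. For $h$ locally integrable with respect to the total variation of $df$, $h\,df$ is the measure with density $h$ with respect to $df$. For $z\in\mathbb{C}$, $\theta_z(x)=1-z^2\Delta_{d\alpha}(x)\Delta_{d\beta}(x)$, and $\theta(x)=\theta_r(x)/\theta_{1-r}(x)$, $x\in(a,b)$. A function $f$ is $r$-balanced if $f\in \mathrm{BV}_{\rm loc}((a,b),\mathbb{C})$ and $f(x)=rf^-(x)+(1-r)f^+(x)$ for all $x\in(a,b)$. A function $u$ is an $r$-balanced solution of $-d(dy/d\alpha)+y\,d\beta=0$ on $(a,b)$ if $u$ is $r$-balanced, $du\ll d\alpha$ (locally), the Radon–Nikodym derivative $du/d\alpha$ is $r$-balanced (i.e. has an $r$-balanced representative, which is then unique because $\alpha$ is strictly increasing, and $du/d\alpha$ denotes that representative), and $-d(du/d\alpha)+u\,d\beta=0$ as measures. For $f\in \mathrm{BV}_{\rm loc}((a,b),\mathbb{R})$ and a subinterval $I\subset(a,b)$,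 $\mathcal{Z}_I(f)=\{x\in I: f^-(x)f^+(x)\le0\}$. Points $s<t$ of $\mathcal{Z}_{(a,b)}(u)$ are consecutive if $\mathcal{Z}_{(a,b)}(u)\cap(s,t)=\emptyset$. A nontrivial real-valued $r$-balanced solution $w$ changes sign at $x_0\in(a,b)$ if there is $\delta>0$ such that $w^-<0$ on $(x_0-\delta,x_0)$ and $w^+>0$ on $(x_0,x_0+\delta)$, or $w^->0$ on $(x_0-\delta,x_0)$ and $w^+<0$ on $(x_0,x_0+\delta)$. It changes sign in a subinterval $I$ of $(a,b)$ if it changes sign at some point of $I$. *)

(* Defs.v *)
From HB Require Import structures.
From mathcomp Require Import all_boot all_order all_algebra.
From mathcomp Require Import all_classical all_reals all_analysis.
From mathcomp Require Import ring lra.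

Set Implicit Arguments.
Unset Strict Implicit.
Unset Printing Implicit Defensive.

Import Order.TTheory GRing.Theory Num.Theory.
Import numFieldNormedType.Exports.

Local Open Scope classical_set_scope.
Local Open Scope ring_scope.

Section BalancedSolutions.
Context {R : realType}.
Implicit Types (a b : \bar R) (r z c d x y : R) (I : set R).
Implicit Types (f g h u v w alpha beta : R -> R).
Implicit Type A : set (measurableTypeR R).
Implicit Type nu : {charge set (measurableTypeR R) -> \bar R}.

(* Functions on (a, b) are represented by total functions R -> R; only their  *)
(* values on oitv a b matter.                                                 *)
Definition oitv a b : set R := [set x | (a < x%:E)%E /\ (x%:E < b)%E].

Definition BVloc a b f : Prop :=
  forall c d, oitv a b c -> oitv a b d -> c < d -> bounded_variation c d f.

Definition llim f x : R := lim (f t @[t --> x^'-]).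
Definition rlim f x : R := lim (f t @[t --> x^'+]).
Definition jump f x : R := rlim f x - llim f x.

(* The locally finite signed measure df on (a, b) is handled through its      *)
(* restrictions to the intervals ]c, d[ with c, d in (a, b): these are finite *)
(* signed measures, seen as charges on R that are concentrated on ]c, d[.     *)
Definition generates c d f nu : Prop :=
  (forall A, measurable A -> nu A = nu (A `&` `]c, d[%classic)) /\
  (forall x y, c < x -> x < y -> y < d ->
    nu `[x, y[%classic = (llim f y - llim f x)%:E).

(* When f has bounded variation on [c, d], dmeas c d f is the one charge      *)
(* generated by f on ]c, d[, by generates_exists and generates_unique below.  *)
Definition dmeas c d f : {charge set (measurableTypeR R) -> \bar R} :=
  match pselect (exists nu, generates c d f nu) with
  | left ex => projT1 (cid ex)
  | right _ => czero
  end.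

Definition hahn_posset nu := projT1 (cid (Hahn_decomposition nu)).
Definition hahn_negset nu :=
  projT1 (cid (projT2 (cid (Hahn_decomposition nu)))).

Lemma hahn_setsP nu : hahn_decomposition nu (hahn_posset nu) (hahn_negset nu).
Proof. exact: projT2 (cid (projT2 (cid (Hahn_decomposition nu)))). Qed.

Definition jpos nu : {finite_measure set (measurableTypeR R) -> \bar R} :=
  jordan_pos (hahn_setsP nu).
Definition jneg nu : {finite_measure set (measurableTypeR R) -> \bar R} :=
  jordan_neg (hahn_setsP nu).

(* The value at A of the measure h dnu, for a signed measure nu. It does not  *)
(* depend on the Hahn decomposition, by Hahn_decomposition_uniq.              *)
Definition density nu h A : \bar R :=
  (\int[jpos nu]_(x in A) (h x)%:E - \int[jneg nu]_(x in A) (h x)%:E)%E.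

Definition balanced r a b f : Prop :=
  BVloc a b f /\
  forall x, oitv a b x -> f x = r * llim f x + (1 - r) * rlim f x.

Definition is_RN_derivative a b alpha u g : Prop :=
  forall c d, oitv a b c -> oitv a b d -> c < d ->
    (dmeas c d u `<< dmeas c d alpha) /\
    (forall A, measurable A -> A `<=` `]c, d[ ->
       dmeas c d u A = density (dmeas c d alpha) g A).

(* g is the r-balanced representative of du/dalpha.                           *)
Definition balanced_solution r a b alpha beta u : Prop :=
  balanced r a b u /\
  exists g, [/\ balanced r a b g, is_RN_derivative a b alpha u g &
    forall c d, oitv a b c -> oitv a b d -> c < d ->
    forall A, measurable A -> A `<=` `]c, d[ ->
      (- dmeas c d g A + density (dmeas c d beta) u A = 0)%E].

Definition lin_indep a b u v : Prop :=
  forall k l : R, (forall x, oitv a b x -> k * u x + l * v x = 0) ->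
    k = 0 /\ l = 0.

Definition theta alpha beta z x : R :=
  1 - z ^+ 2 * jump alpha x * jump beta x.

Definition theta_ratio alpha beta r x : R :=
  theta alpha beta r x / theta alpha beta (1 - r) x.

Definition zeros I f : set R := [set x | I x /\ llim f x * rlim f x <= 0].

Definition consecutive_zeros a b f (s t : R) : Prop :=
  [/\ zeros (oitv a b) f s, zeros (oitv a b) f t, s < t &
      zeros (oitv a b) f `&` `]s, t[ = set0].

Definition changes_sign_at a b w (x0 : R) : Prop :=
  oitv a b x0 /\
  exists e : R, [/\ 0 < e, `]x0 - e, x0 + e[ `<=` oitv a b &
    ((forall x, x0 - e < x < x0 -> llim w x < 0) /\
     (forall x, x0 < x < x0 + e -> 0 < rlim w x)) \/
    ((forall x, x0 - e < x < x0 -> 0 < llim w x) /\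
     (forall x, x0 < x < x0 + e -> rlim w x < 0))].

Definition changes_sign_in a b w I : Prop :=
  exists2 x0, I x0 & changes_sign_at a b w x0.

Lemma nd_cvg_rlim h x : nondecreasing h -> h t @[t --> x^'+] --> rlim h x.
Proof.
move=> ndh; apply: (@nondecreasing_at_right_is_cvgr _ h x).
- by near=> y => p q _ _; exact: ndh.
- near=> y; exists (h x) => _ [t /= txy <-]; apply: ndh.
  by move: txy; rewrite in_itv/= => /andP[/ltW].
Unshelve. all: by end_near. Qed.

Lemma nd_cvg_llim h x : nondecreasing h -> h t @[t --> x^'-] --> llim h x.
Proof.
move=> ndh; apply: (@nondecreasing_at_left_is_cvgr _ h x).
- by near=> y => p q _ _; exact: ndh.
- near=> y; exists (h x) => _ [t /= txy <-]; apply: ndh.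
  by move: txy; rewrite in_itv/= => /andP[_ /ltW].
Unshelve. all: by end_near. Qed.

Lemma nd_rlim_le h x y : nondecreasing h -> x < y -> rlim h x <= h y.
Proof.
move=> ndh xy; apply: limr_le.
  by apply: (cvgP (rlim h x)); exact: nd_cvg_rlim.
by near=> t; apply: ndh; apply: ltW; near: t; exact: nbhs_right_lt.
Unshelve. all: by end_near. Qed.

Lemma nd_rlim_ge h x y : nondecreasing h -> y <= x -> h y <= rlim h x.
Proof.
move=> ndh xy; apply: limr_ge.
  by apply: (cvgP (rlim h x)); exact: nd_cvg_rlim.
near=> t; apply: ndh; apply: (le_trans xy).
by apply: ltW; near: t; exact: nbhs_right_gt.
Unshelve. all: by end_near. Qed.

Lemma nd_llim_ge h x y : nondecreasing h -> y < x -> h y <= llim h x.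
Proof.
move=> ndh xy; apply: limr_ge.
  by apply: (cvgP (llim h x)); exact: nd_cvg_llim.
by near=> t; apply: ndh; apply: ltW; near: t; exact: nbhs_left_gt.
Unshelve. all: by end_near. Qed.

Lemma nd_rlim_nd h : nondecreasing h -> nondecreasing (rlim h).
Proof.
move=> ndh x y; rewrite le_eqVlt => /predU1P[->//|xy].
by rewrite (le_trans (nd_rlim_le ndh xy))// nd_rlim_ge.
Qed.

Lemma nd_rlim_rc h : nondecreasing h ->
  forall x, rlim h @ x^'+ --> rlim h x.
Proof.
move=> ndh x; apply/cvgrPdist_le => e e0.
have [t xt ht] : exists2 t, x < t & h t <= rlim h x + e.
  near x^'+ => t; exists t; first by near: t; exact: nbhs_right_gt.
  rewrite -lerBlDl; apply: le_trans (ler_norm _) _; rewrite distrC.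
  by near: t; move: e e0; apply/cvgrPdist_le; exact: nd_cvg_rlim.
near=> y.
have xy : x < y by near: y; exact: nbhs_right_gt.
have yt : y < t by near: y; exact: nbhs_right_lt.
rewrite ler0_norm ?subr_le0 ?nd_rlim_nd// ?(ltW xy)// opprB.
by rewrite lerBlDl (le_trans (nd_rlim_le ndh yt)).
Unshelve. all: by end_near. Qed.

Lemma nd_llim_rlim h x : nondecreasing h ->
  rlim h t @[t --> x^'-] --> llim h x.
Proof.
move=> ndh; apply: (@squeeze_cvgr _ _ _ _ h (cst (llim h x))).
- near=> t; have tx : t < x by near: t; exact: nbhs_left_lt.
  rewrite nd_rlim_ge//=.
  have [m /andP[tm mx]] : exists m, t < m < x.
    by exists ((t + x) / 2); rewrite !midf_lt.
  by rewrite (le_trans (nd_rlim_le ndh tm))// nd_llim_ge.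
- exact: nd_cvg_llim.
- exact: cvg_cst.
Unshelve. all: by end_near. Qed.


Lemma lsm_itvoc (G : cumulative R R) x y : x <= y ->
  lebesgue_stieltjes_measure G `]x, y]%classic = (G y - G x)%:E.
Proof.
move=> xy; rewrite /lebesgue_stieltjes_measure /measure_extension/=.
by rewrite measurable_mu_extE/= ?wlength_itv_bnd//; exact: is_ocitv.
Qed.

Lemma lsm_set1 (G : cumulative R R) x (l : R) :
  G t @[t --> x^'-] --> l ->
  lebesgue_stieltjes_measure G [set x] = (G x - l)%:E.
Proof.
move=> Gl; pose F (n : nat) := `](x - n.+1%:R^-1), x]%classic.
have FE n : lebesgue_stieltjes_measure G (F n) = (G x - G (x - n.+1%:R^-1))%:E.
  by rewrite lsm_itvoc// gerBl invr_ge0.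
have F1 : lebesgue_stieltjes_measure G \o F @ \oo -->
    lebesgue_stieltjes_measure G (\bigcap_n F n).
  apply: nonincreasing_cvg_mu => //.
  - by rewrite -[ltLHS]/(lebesgue_stieltjes_measure G (F 0%N)) FE ltry.
  - by move=> n; exact: measurable_itv.
  - by rewrite -set1_bigcap_oc; exact: measurable_set1.
  - move=> m n mn; apply/subsetPset; apply: subset_itvr.
    by rewrite bnd_simp lerD2l lerN2 lef_pV2 ?posrE// ler_nat.
rewrite set1_bigcap_oc; apply: (cvg_unique _ F1).
  exact: ereal_hausdorff.
rewrite (_ : _ \o F = EFin \o (fun n => G x - G (x - n.+1%:R^-1))); last first.
  by apply/funext => n /=; rewrite FE.
apply: cvg_EFin; first by near=> n.
apply: cvgB; first exact: cvg_cst.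
move/cvg_at_leftP : Gl; apply; split=> [n|]; first by rewrite gtrBl.
rewrite -[X in _ --> X]subr0; apply: cvgB; first exact: cvg_cst.
by rewrite gtr0_cvgV0 ?cvg_shiftS; [exact: cvgr_idn | near=> n].
Unshelve. all: by end_near. Qed.


Lemma lsm_itvco (G : cumulative R R) h x y : nondecreasing h ->
  G =1 rlim h -> x < y ->
  lebesgue_stieltjes_measure G `[x, y[%classic = (llim h y - llim h x)%:E.
Proof.
move=> ndh Gh xy; set mu := lebesgue_stieltjes_measure G.
have G1 z : mu [set z] = (rlim h z - llim h z)%:E.
  rewrite /mu (@lsm_set1 _ _ (llim h z)) ?Gh//.
  by rewrite (_ : _ G = rlim h); [exact: nd_llim_rlim|exact/funext].
have : (mu [set x] + mu `]x, y]%classic = mu `[x, y[%classic + mu [set y])%E.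
  rewrite -measureU//; last 1 first.
    by apply/seteqP; split=> // z [/= ->]; rewrite in_itv/= ltxx.
  rewrite -measureU//; last 1 first.
    by apply/seteqP; split=> // z [/= + zy]; rewrite in_itv/= zy ltxx andbF.
  by rewrite setU1itv ?bnd_simp ?ltW// setUitv1 ?bnd_simp ?ltW.
rewrite !G1 [X in (_ + X)%E]lsm_itvoc ?ltW// !Gh -EFinD => e.
have -> : mu `[x, y[%classic = ((mu `[x, y[%classic + (rlim h y - llim h y)%:E)
    - (rlim h y - llim h y)%:E)%E by rewrite addeK.
by rewrite -e -EFinB; congr (_%:E); ring.
Qed.

Lemma llim_near_eq f g c x : c < x -> {in `]c, x[, f =1 g} ->
  llim f x = llim g x.
Proof.
move=> cx fg.
have H u v : {in `]c, x[, u =1 v} ->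
    (u t @[t --> x^'-]) `=>` (v t @[t --> x^'-]).
  move=> uv; apply: near_eq_cvg; near=> t; apply/esym/uv.
  rewrite in_itv/=; apply/andP; split; near: t.
    exact: nbhs_left_gt.
  exact: nbhs_left_lt.
rewrite /llim; congr (lim _); apply/seteqP; split.
  by apply: H => t /fg.
exact: H.
Unshelve. all: by end_near. Qed.

Lemma generates_nd c d f : c < d ->
  {in `[c, d] &, nondecreasing f} ->
  exists nu, generates c d f nu.
Proof.
move=> cd ndf; pose h x := f (Num.max c (Num.min x d)).
have clipP x : Num.max c (Num.min x d) \in `[c, d].
  by rewrite in_itv/= le_max lexx/= ge_max (ltW cd)/= ge_min lexx orbT.
have ndh : nondecreasing h.
  move=> x y xy; apply: ndf => //.
  by rewrite ge_max !le_max lexx/= le_min !ge_min xy lexx !orbT.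
pose G : cumulative R R := HB.pack (rlim h)
  (isCumulative.Build R _ R (rlim h) (nd_rlim_nd ndh) (nd_rlim_rc ndh)).
pose mu := mrestr (lebesgue_stieltjes_measure G) (measurable_itv `]c, d[).
have mufin : fin_num_fun mu.
  move=> A mA; rewrite ge0_fin_numE//.
  rewrite (@le_lt_trans _ _ (lebesgue_stieltjes_measure G `]c, d]%classic))//.
    apply: le_measure; rewrite ?inE//; first exact: measurableI.
    move=> x [_ /=]; rewrite !in_itv/= => /andP[-> /ltW//].
  by rewrite lsm_itvoc ?ltW// ltry.
pose mu' : {finite_measure set (measurableTypeR R) -> \bar R} :=
  HB.pack mu (Measure_isFinite.Build _ _ _ mu mufin).
exists (charge_of_finite_measure mu'); split => [A mA|x y cx xy yd].
  by rewrite /charge_of_finite_measure/= /mu /mrestr -setIA setIid.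
rewrite /charge_of_finite_measure/= /mu /mrestr setIidl; last first.
  move=> t /=; rewrite !in_itv/= => /andP[xt ty].
  by rewrite (lt_le_trans cx)// (lt_trans ty).
rewrite (@lsm_itvco G h)//; congr (_ - _)%:E;
  (apply: (@llim_near_eq _ _ c); [|move=> t]).
- exact: (lt_trans cx).
- rewrite in_itv/= => /andP[ct ty]; rewrite /h min_l ?max_r ?ltW//.
  exact: (lt_trans ty).
- by [].
- rewrite in_itv/= => /andP[ct ty]; rewrite /h min_l ?max_r ?ltW//.
  exact: (lt_trans ty (lt_trans xy yd)).
Qed.

Lemma nd_in_cvg_llim c d f x : {in `[c, d] &, nondecreasing f} ->
  c < x -> x < d -> f t @[t --> x^'-] --> llim f x.
Proof.
move=> ndf cx xd; apply: (@nondecreasing_at_left_is_cvgr _ f x); near=> y.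
all: have cy : c < y by near: y; exact: nbhs_left_gt.
all: have sub t : t \in `]y, x[ -> t \in `[c, d].
- by rewrite !in_itv/= => /andP[yt tx];
    rewrite !ltW ?(lt_trans cy)// (lt_trans tx).
- by move=> p q /sub ? /sub ?; exact: ndf.
- by rewrite !in_itv/= => /andP[yt tx];
    rewrite !ltW ?(lt_trans cy)// (lt_trans tx).
exists (f x) => _ [t /= txy <-]; apply: ndf; first exact: sub.
  by rewrite in_itv/= !ltW.
by move: txy; rewrite in_itv/= => /andP[_ /ltW].
Unshelve. all: by end_near. Qed.

Lemma generates_exists c d f : c < d -> bounded_variation c d f ->
  exists nu, generates c d f nu.
Proof.
move=> cd bvf; set P := fine \o pos_tv c f; set N := fine \o neg_tv c f.
have ndN : {in `[c, d] &, nondecreasing N} by exact: fine_neg_tv_nondecreasing.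
have ndP : {in `[c, d] &, nondecreasing P}.
  by apply: fine_neg_tv_nondecreasing; exact: bounded_variationN.
have [nuP [P1 P2]] := generates_nd cd ndP.
have [nuN [N1 N2]] := generates_nd cd ndN.
have fPN x : c < x -> x < d -> llim f x = llim P x - llim N x.
  move=> cx xd.
  have cvg_nd g : {in `[c, d] &, nondecreasing g} ->
      g t @[t --> x^'-] --> llim g x.
    by move=> ndg; exact: nd_in_cvg_llim ndg cx xd.
  rewrite (@llim_near_eq _ (P \- N) c)//; last first.
    move=> t; rewrite in_itv/= => /andP[ct tx].
    rewrite (bounded_variation_pos_neg_tvE bvf)// in_itv/= !ltW//.
    exact: lt_trans xd.
  by apply: cvg_lim => //; apply: cvgB; exact: cvg_nd.
exists (cadd nuP (copp nuN)); split => [A mA|x y cx xy yd].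
  rewrite -[LHS]/(nuP A - nuN A)%E.
  by rewrite -[RHS]/(nuP (A `&` `]c, d[%classic)
                     - nuN (A `&` `]c, d[%classic))%E -P1// -N1.
rewrite -[LHS]/(nuP `[x, y[%classic - nuN `[x, y[%classic)%E.
rewrite P2// N2// -EFinB !fPN//.
- by congr (_%:E); ring.
- exact: lt_trans yd.
- exact: lt_trans xy.
Qed.

Lemma dmeasP c d f : c < d -> bounded_variation c d f ->
  generates c d f (dmeas c d f).
Proof.
move=> cd bvf; rewrite /dmeas.
case: pselect => [ex|/(_ (generates_exists cd bvf))//].
exact: projT2 (cid ex).
Qed.

Lemma jordanE nu A : measurable A -> nu A = (jpos nu A - jneg nu A)%E.
Proof.
by move=> mA; rewrite (jordan_decomp (hahn_setsP nu) mA) /cadd/= cscaleN1.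
Qed.

Lemma charge_cvg nu (F : (set R)^nat) A :
  (forall n, measurable (F n : set (measurableTypeR R))) ->
  nondecreasing_seq F -> \bigcup_n F n = A ->
  nu (F n) @[n --> \oo] --> nu A.
Proof.
move=> mF ndF <-.
have mU : measurable (\bigcup_n F n : set (measurableTypeR R)).
  by exact: bigcup_measurable.
rewrite jordanE// (_ : (fun n => nu (F n)) =
    (fun n => jpos nu (F n) - jneg nu (F n))%E); last first.
  by apply/funext => n; rewrite jordanE.
apply: cvgeB.
- by rewrite fin_num_adde_defr// fin_num_measure.
- exact: (@nondecreasing_cvg_mu _ _ _ (jpos nu) F).
- exact: (@nondecreasing_cvg_mu _ _ _ (jneg nu) F).
Qed.

Lemma generates_unique c d f nu1 nu2 : c < d ->
  generates c d f nu1 -> generates c d f nu2 ->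
  forall A, measurable A -> nu1 A = nu2 A.
Proof.
move=> cd [c1 e1] [c2 e2].
have E x : nu1 `[x, +oo[%classic = nu2 `[x, +oo[%classic.
  rewrite c1// c2//.
  pose F n := `[Num.max x (c + n.+1%:R^-1), d - n.+1%:R^-1[%classic.
  have mF n : measurable (F n : set (measurableTypeR R)).
    by exact: measurable_itv.
  have ndF : nondecreasing_seq F.
    move=> m n mn; apply/subsetPset => t; rewrite /F /= !in_itv/= !ge_max.
    have : n.+1%:R^-1 <= m.+1%:R^-1 :> R by rewrite lef_pV2 ?posrE// ler_nat.
    move: (n.+1%:R^-1) (m.+1%:R^-1) => p q ? /andP[/andP[-> ?] ?] /=;
      apply/andP; split; lra.
  have UF : \bigcup_n F n = `[x, +oo[%classic `&` `]c, d[%classic.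
    apply/seteqP; split=> [t [n _]|t []]; rewrite /F /= !in_itv/= ?ge_max.
      have : 0 < n.+1%:R^-1 :> R by rewrite invr_gt0.
      move: (n.+1%:R^-1) => p ? /andP[/andP[-> ?] ?] /=;
        split=> //; apply/andP; split; lra.
    rewrite andbT => xt /andP[ct td].
    have : \forall n \near \oo, n.+1%:R^-1 < Num.min (t - c) (d - t).
      have e0 : 0 < Num.min (t - c) (d - t) by rewrite lt_min !subr_gt0 ct td.
      exact: near_infty_natSinv_lt (PosNum e0).
    case=> n _ /(_ n (leqnn _)) /=; rewrite lt_min => /andP[n1 n2].
        exists n => //=; rewrite /F/= in_itv/= ge_max xt/=.
    move: (n.+1%:R^-1) n1 n2 => p n1 n2; apply/andP; split; lra.
  have Fe n : nu1 (F n) = nu2 (F n).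
    have n0 : 0 < n.+1%:R^-1 :> R by rewrite invr_gt0.
    rewrite /F.
    have [lt_|ge_] := ltP (Num.max x (c + n.+1%:R^-1)) (d - n.+1%:R^-1).
      rewrite e1 ?e2//; do ?[by rewrite lt_max ltrDl n0 orbT|by rewrite gtrBl].
    by rewrite set_itv_ge ?charge0// bnd_simp -leNgt.
  have H1 := charge_cvg (nu := nu1) mF ndF UF.
  have H2 := charge_cvg (nu := nu2) mF ndF UF.
  rewrite (funext Fe) in H1.
  exact: cvg_unique H1 H2.
have S (A : set (measurableTypeR R)) : measurable A ->
  nu1 A = nu2 A <->
  measure_add (jpos nu1) (jneg nu2) A = measure_add (jpos nu2) (jneg nu1) A.
  move=> mA; rewrite !measure_addE !jordanE//.
  have aux (p q r s : \bar R) : p \is a fin_num -> q \is a fin_num ->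
      r \is a fin_num -> s \is a fin_num ->
      (p - q = r - s)%E <-> (p + s = r + q)%E.
    case: p q r s => [p| |] [q| |] [r| |] [s| |]// _ _ _ _.
    by rewrite -!EFinB -!EFinD; split=> -[] ?; congr (_%:E); lra.
  by apply: aux; exact: fin_num_measure.
move=> A mA; apply/(S _ mA).
pose m1 : {measure set (measurableTypeR R) -> \bar R} :=
  measure_add (jpos nu1) (jneg nu2).
pose m2 : {measure set (measurableTypeR R) -> \bar R} :=
  measure_add (jpos nu2) (jneg nu1).
apply: (@measure_unique _ R (measurableTypeR R)
  (@measurable_realfun.RGenCInfty.G R)
  (fun k : nat => `[(- k%:R : R), +oo[%classic) _ _ _ _ m1 m2) => //.
- exact: measurable_realfun.RGenCInfty.measurableE.
- move=> _ _ [x ->] [y ->]; exists (Num.max x y).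
  by apply/seteqP; split=> t /=; rewrite !in_itv/= !andbT ge_max => /andP.
- by move=> k; exists (- k%:R).
- apply/seteqP; split=> // t _; exists (Num.bound `|t|) => //=.
  rewrite in_itv/= andbT lerNl (le_trans (ler_norm _))//.
  by rewrite normrN ltW// archi_boundP.
- by move=> _ [x ->]; apply/S.
- move=> k; rewrite /m1 [ltLHS]measure_addE -ge0_fin_numE ?adde_ge0// fin_numD.
  by rewrite !fin_num_measure.
Qed.

End BalancedSolutions.

(* Main.v *)
(* With g = du/dalpha and h = dv/dalpha, the Wronskian W = u h - v g satisfies
   W^- = theta_{1-r} W and W^+ = theta_r W at every point, and it vanishes
   nowhere: at a zero of W some nontrivial combination of (u, g) and (v, h)
   would have zero data, hence vanish on (a, b).  Thus W^+ = theta W^-, and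
   W^+(s) and W^-(t) have the same sign because theta > 0 on (s, t).  At the
   zeros s and t of u, W reduces to minus the product of a value of g, whose
   sign is dictated by the strict sign of u on (s, t), and a one-sided limit of
   v; hence v has opposite signs next to s and next to t.  A nontrivial solution
   has a strict sign on each side of every point, so by connectedness v changes
   sign in between.  The quotient v/u need not be monotone, since theta_r and
   theta_{1-r} may both be negative. *)

From HB Require Import structures.
Require Import Defs.
From mathcomp Require Import all_boot all_order all_algebra.
From mathcomp Require Import all_classical all_reals all_analysis.
From mathcomp Require Import measurable_realfun.
From mathcomp Require Import ring lra.

Set Implicit Arguments.
Unset Strict Implicit.
Unset Printing Implicit Defensive.

Import Order.TTheory GRing.Theory Num.Theory.
Import numFieldNormedType.Exports.

Local Open Scope classical_set_scope.
Local Open Scope ring_scope.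

(** * One-sided limits *)

Section OneSidedLimits.
Context {R : realType}.
Implicit Types (a b : \bar R) (x y z s t c d k l m e : R) (f g : R -> R).

(** The functions u and g satisfy the system du = g dalpha, dg = u dbeta. At a point this is a
    linear relation between the balanced values and the one-sided limits, with a matrix of
    determinant theta_{1-r} on the left and theta_r on the right. The two factors of the Wronskian
    and the passage of zero data through a jump both come from these matrices. Uniqueness, the sign
    of a solution and the sign of W are instead carried along intervals by one supremum argument,
    [interval_constancy], in which left and right values are separate functions that agree at
    interior points. Signs are booleans, so each of the four cases ends in an identity between
    exclusive disjunctions. The sign conditions on theta at the end points have this origin: where
    u^-(s) = 0, balance gives W(s) = - v^-(s) g(s), and theta_r(s) compares W(s) with W^+(s); at t
    the same happens with u^+(t) = 0, v^+(t) and theta_{1-r}(t). *)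

Lemma near_rightP x (P : set R) :
  (\forall z \near x^'+, P z) <->
  exists2 e, 0 < e & forall z, x < z < x + e -> P z.
Proof.
split=> [[e /= e0 H]|[e e0 H]].
  exists e => // z /andP[xz ze]; apply: H => //=.
  by rewrite distrC gtr0_norm ?subr_gt0// ltrBlDl.
near=> z; apply: H; apply/andP; split; near: z; first exact: nbhs_right_gt.
by apply: nbhs_right_lt; rewrite ltrDl.
Unshelve. all: by end_near. Qed.

Lemma near_leftP x (P : set R) :
  (\forall z \near x^'-, P z) <->
  exists2 e, 0 < e & forall z, x - e < z < x -> P z.
Proof.
split=> [[e /= e0 H]|[e e0 H]].
  exists e => // z /andP[xz ze]; apply: H => //=.
  by rewrite gtr0_norm ?subr_gt0// ltrBlDl -ltrBlDr.
near=> z; apply: H; apply/andP; split; near: z; last exact: nbhs_left_lt.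
by apply: nbhs_left_gt; rewrite ltrBlDr ltrDl.
Unshelve. all: by end_near. Qed.

Lemma near_oo s t (P : set R) x : s < x < t ->
  (forall z, s < z < t -> P z) ->
  (\forall z \near x^'-, P z) /\ (\forall z \near x^'+, P z).
Proof.
move=> /andP[sx xt] H; split.
  apply/near_leftP; exists (x - s); first by rewrite subr_gt0.
  by move=> z; rewrite subKr => /andP[sz zx]; apply: H; rewrite sz (lt_trans zx).
apply/near_rightP; exists (t - x); first by rewrite subr_gt0.
by move=> z /andP[xz]; rewrite subrKC => zt; apply: H; rewrite zt (lt_trans sx).
Qed.

(** A point just to the right of x is interior to the open interval on which P holds. Bounds near x
    thereby reach the one-sided limits at the neighbouring points. *)
Lemma near_right_near x (P : set R) : (\forall z \near x^'+, P z) ->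
  \forall z \near x^'+, [/\ P z, \forall w \near z^'-, P w &
    \forall w \near z^'+, P w].
Proof.
move=> /near_rightP[e e0 H]; apply/near_rightP; exists e => // z xz.
by have [? ?] := near_oo xz H; split=> //; exact: H.
Qed.

Lemma near_left_near x (P : set R) : (\forall z \near x^'-, P z) ->
  \forall z \near x^'-, [/\ P z, \forall w \near z^'-, P w &
    \forall w \near z^'+, P w].
Proof.
move=> /near_leftP[e e0 H]; apply/near_leftP; exists e => // z xz.
by have [? ?] := near_oo xz H; split=> //; exact: H.
Qed.

(** Connectedness of [s, t], for data with jumps: L x is what is seen from the left of x and Q x
    what is seen from the right. The common value spreads from s to the right, crosses each interior
    point because L = Q there, and reaches t from the left. *)
Lemma interval_constancy (T : Type) (L Q : R -> T) s t : s < t ->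
  (forall x, s < x < t -> L x = Q x) ->
  (forall x, s <= x < t -> \forall z \near x^'+, L z = Q x) ->
  (forall x, s < x <= t -> \forall z \near x^'-, Q z = L x) ->
  Q s = L t.
Proof.
move=> st LQ HR HL.
(* The condition bears on the open interval only, so s belongs to [E] vacuously and everything below
   the supremum satisfies it. *)
pose E := [set y | s <= y <= t /\ forall z, s < z < y -> L z = Q s].
have Es : E s.
  by split=> [|z /andP[sz /(lt_trans sz)]]; rewrite ?ltxx// lexx ltW.
have ubE : has_ubound E by exists t => y [] /andP[].
have mt : sup E <= t by apply: ge_sup; [exists s|move=> y [] /andP[]].
have before z : s < z -> z < sup E -> L z = Q s.
  move=> sz zm; have e0 : 0 < sup E - z by rewrite subr_gt0.
  have hasE : has_sup E by split; [exists s|].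
  have [y [_ Hy] zy] := sup_adherent e0 hasE.
  by apply: Hy; rewrite sz /=; move: zy; rewrite subKr.
have ext y : s <= y -> y < t -> (forall z, s < z <= y -> L z = Q s) ->
    Q y = Q s -> y < sup E.
  move=> sy yt H Qy; have syt : s <= y < t by rewrite sy.
  have /near_rightP[e e0 He] := HR _ syt.
  have [m /andP[ym mm]] : exists m, y < m < Num.min t (y + e).
    have ym : y < Num.min t (y + e) by rewrite lt_min yt ltrDl.
    by exists ((y + Num.min t (y + e)) / 2); rewrite !midf_lt.
  rewrite lt_min in mm; case/andP: mm => mt' me.
  apply: (lt_le_trans ym); apply: ub_le_sup => //; split.
    by rewrite (le_trans sy (ltW ym)) ltW.
  move=> z /andP[sz zm]; have [zy|yz] := leP z y; first by rewrite H ?sz.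
  by rewrite He ?Qy// yz (lt_trans zm).
have sm : s < sup E.
  by apply: ext => // z /andP[sz /(lt_le_trans sz)]; rewrite ltxx.
have smt : s < sup E <= t by rewrite sm.
have Lm : L (sup E) = Q s.
  near (sup E)^'- => z.
  have sz : s < z by near: z; exact: nbhs_left_gt.
  have zm : z < sup E by near: z; exact: nbhs_left_lt.
  have <- : Q z = L (sup E) by near: z; exact: HL.
  by rewrite -LQ ?sz/= ?(lt_le_trans zm)// before.
move: mt; rewrite le_eqVlt => /orP[/eqP <- //|mt].
suff : sup E < sup E by rewrite ltxx.
apply: ext => //; first exact: ltW.
  by move=> z /andP[sz]; rewrite le_eqVlt => /orP[/eqP ->//|]; exact: before.
by rewrite -LQ ?sm.
Unshelve. all: by end_near. Qed.

(** Since [lim] returns a default value when there is no limit, convergence to [llim f x] and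
    [rlim f x] is what expresses that both limits exist. *)
Definition regulated (D : set R) f := forall x, D x ->
  f z @[z --> x^'-] --> llim f x /\ f z @[z --> x^'+] --> rlim f x.

Lemma llim_eq f x l : f z @[z --> x^'-] --> l -> llim f x = l.
Proof. exact: cvg_lim. Qed.

Lemma rlim_eq f x l : f z @[z --> x^'+] --> l -> rlim f x = l.
Proof. exact: cvg_lim. Qed.

Lemma oitv_oo a b x : oitv a b x ->
  exists c d, [/\ oitv a b c, oitv a b d & c < x < d].
Proof.
have H : (a < x%:E)%E -> (x%:E < b)%E -> exists c d,
    [/\ (a < c%:E)%E, (d%:E < b)%E & c < x < d].
  move=> ax xb.
  have [c ac cx] : exists2 c, (a < c%:E)%E & c < x.
    case: a ax => [a|//|_]; last by exists (x - 1); rewrite ?ltNyr// gtrBl.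
    by rewrite lte_fin => ax; exists ((a + x) / 2); rewrite ?lte_fin midf_lt.
  have [d db xd] : exists2 d, (d%:E < b)%E & x < d.
    case: b xb => [b|_|//]; last by exists (x + 1); rewrite ?ltry// ltrDl.
    by rewrite lte_fin => xb; exists ((x + b) / 2); rewrite ?lte_fin midf_lt.
  by exists c, d; rewrite ac db cx xd.
case=> ax xb; have [c [d [ac db /andP[cx xd]]]] := H ax xb.
exists c, d; split; last by rewrite cx.
  by split=> //; apply: lt_trans xb; rewrite lte_fin.
by split=> //; apply: (lt_trans ax); rewrite lte_fin.
Qed.

Lemma oitv_between a b c d x : oitv a b c -> oitv a b d -> c <= x <= d ->
  oitv a b x.
Proof.
move=> [ac _] [_ db] /andP[cx xd]; split.
  by apply: (lt_le_trans ac); rewrite lee_fin.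
by apply: le_lt_trans db; rewrite lee_fin.
Qed.

Lemma oitv_near a b x : oitv a b x ->
  (\forall z \near x^'-, oitv a b z) /\ (\forall z \near x^'+, oitv a b z).
Proof.
move=> /oitv_oo[c [d [Ic Id cxd]]]; apply: (near_oo cxd) => z /andP[cz zd].
by apply: (oitv_between Ic Id); rewrite !ltW.
Qed.

Lemma regulated_ge a b f x m : regulated (oitv a b) f -> oitv a b x ->
  (\forall z \near x^'-, m <= f z) -> m <= llim f x.
Proof.
move=> rf /rf[fx _] H; apply: limr_ge => //; exact: (cvgP (llim f x)).
Qed.

Lemma regulated_right_ge a b f x m : regulated (oitv a b) f -> oitv a b x ->
  (\forall z \near x^'+, m <= f z) -> m <= rlim f x.
Proof.
move=> rf /rf[_ fx] H; apply: limr_ge => //; exact: (cvgP (rlim f x)).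
Qed.

Lemma near_right_ge a b f x m : regulated (oitv a b) f -> oitv a b x ->
  (\forall z \near x^'+, m <= f z) ->
  \forall z \near x^'+, [/\ m <= llim f z, m <= f z & m <= rlim f z].
Proof.
move=> rf Ix /near_right_near H; near=> z.
have Iz : oitv a b z by near: z; have [] := oitv_near Ix.
have [? ? ?] : [/\ m <= f z, \forall w \near z^'-, m <= f w &
    \forall w \near z^'+, m <= f w] by near: z.
by split=> //; [exact: regulated_ge rf Iz _|exact: regulated_right_ge rf Iz _].
Unshelve. all: by end_near. Qed.

Lemma near_left_ge a b f x m : regulated (oitv a b) f -> oitv a b x ->
  (\forall z \near x^'-, m <= f z) ->
  \forall z \near x^'-, [/\ m <= llim f z, m <= f z & m <= rlim f z].
Proof.
move=> rf Ix /near_left_near H; near=> z.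
have Iz : oitv a b z by near: z; have [] := oitv_near Ix.
have [? ? ?] : [/\ m <= f z, \forall w \near z^'-, m <= f w &
    \forall w \near z^'+, m <= f w] by near: z.
by split=> //; [exact: regulated_ge rf Iz _|exact: regulated_right_ge rf Iz _].
Unshelve. all: by end_near. Qed.

Lemma near_right_gt a b f x m : regulated (oitv a b) f -> oitv a b x ->
  m < rlim f x ->
  \forall z \near x^'+, [/\ m <= llim f z, m <= f z & m <= rlim f z].
Proof.
move=> rf Ix mf; apply: (near_right_ge rf Ix); have [_ fx] := rf _ Ix.
by apply: filterS (cvgr_gt _ fx _ mf) => z /ltW.
Qed.

Lemma near_left_gt a b f x m : regulated (oitv a b) f -> oitv a b x ->
  m < llim f x ->
  \forall z \near x^'-, [/\ m <= llim f z, m <= f z & m <= rlim f z].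
Proof.
move=> rf Ix mf; apply: (near_left_ge rf Ix); have [fx _] := rf _ Ix.
by apply: filterS (cvgr_gt _ fx _ mf) => z /ltW.
Qed.

Lemma regulated_lin a b f g k l :
  regulated (oitv a b) f -> regulated (oitv a b) g ->
  regulated (oitv a b) (fun x => k * f x + l * g x) /\
  forall x, oitv a b x ->
    llim (fun x => k * f x + l * g x) x = k * llim f x + l * llim g x /\
    rlim (fun x => k * f x + l * g x) x = k * rlim f x + l * rlim g x.
Proof.
move=> rf rg.
have H x : oitv a b x ->
    (k * f z + l * g z) @[z --> x^'-] --> k * llim f x + l * llim g x /\
    (k * f z + l * g z) @[z --> x^'+] --> k * rlim f x + l * rlim g x.
  move=> Ix; have [fl fr] := rf _ Ix; have [gl gr] := rg _ Ix.
  by split; apply: cvgD; apply: cvgMr.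
have E x (Ix : oitv a b x) := conj (llim_eq (H x Ix).1) (rlim_eq (H x Ix).2).
by split=> // x Ix; have [-> ->] := E x Ix; exact: H.
Qed.

Lemma regulatedN a b f : regulated (oitv a b) f ->
  regulated (oitv a b) (\- f) /\
  forall x, oitv a b x -> llim (\- f) x = - llim f x /\
                          rlim (\- f) x = - rlim f x.
Proof.
move=> rf.
have H x (Ix : oitv a b x) : (- f z) @[z --> x^'-] --> - llim f x /\
    (- f z) @[z --> x^'+] --> - rlim f x.
  by have [fl fr] := rf _ Ix; split; apply: cvgN.
have E x (Ix : oitv a b x) := conj (llim_eq (H x Ix).1) (rlim_eq (H x Ix).2).
by split=> // x Ix; have [-> ->] := E x Ix; exact: H.
Qed.

Lemma regulatedM a b f g :
  regulated (oitv a b) f -> regulated (oitv a b) g ->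
  regulated (oitv a b) (f \* g) /\
  forall x, oitv a b x -> llim (f \* g) x = llim f x * llim g x /\
    rlim (f \* g) x = rlim f x * rlim g x.
Proof.
move=> rf rg.
have H x : oitv a b x -> (f \* g) z @[z --> x^'-] --> llim f x * llim g x /\
    (f \* g) z @[z --> x^'+] --> rlim f x * rlim g x.
  move=> Ix; have [fl fr] := rf _ Ix; have [gl gr] := rg _ Ix.
  by split; apply: cvgM.
have E x (Ix : oitv a b x) := conj (llim_eq (H x Ix).1) (rlim_eq (H x Ix).2).
by split=> // x Ix; have [-> ->] := E x Ix; exact: H.
Qed.

Lemma near_right_lt a b f x m : regulated (oitv a b) f -> oitv a b x ->
  rlim f x < m ->
  \forall z \near x^'+, [/\ llim f z <= m, f z <= m & rlim f z <= m].
Proof.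
move=> rf Ix fm; have [rN EN] := regulatedN rf.
have mf : - m < rlim (\- f) x by rewrite (EN _ Ix).2 ltrN2.
near=> z.
have Iz : oitv a b z by near: z; have [] := oitv_near Ix.
have [/= + + +] : [/\ - m <= llim (\- f) z, - m <= (\- f) z & - m <= rlim (\- f) z].
  by near: z; exact: near_right_gt rN Ix mf.
by rewrite (EN _ Iz).1 (EN _ Iz).2 !lerN2.
Unshelve. all: by end_near. Qed.

Lemma near_left_lt a b f x m : regulated (oitv a b) f -> oitv a b x ->
  llim f x < m ->
  \forall z \near x^'-, [/\ llim f z <= m, f z <= m & rlim f z <= m].
Proof.
move=> rf Ix fm; have [rN EN] := regulatedN rf.
have mf : - m < llim (\- f) x by rewrite (EN _ Ix).1 ltrN2.
near=> z.
have Iz : oitv a b z by near: z; have [] := oitv_near Ix.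
have [/= + + +] : [/\ - m <= llim (\- f) z, - m <= (\- f) z & - m <= rlim (\- f) z].
  by near: z; exact: near_left_gt rN Ix mf.
by rewrite (EN _ Iz).1 (EN _ Iz).2 !lerN2.
Unshelve. all: by end_near. Qed.

(** Charges are specified through left limits only; this recovers right limits from them. *)
Lemma cvg_llim_right a b f x : regulated (oitv a b) f -> oitv a b x ->
  llim f z @[z --> x^'+] --> rlim f x.
Proof.
move=> rf Ix; apply/cvgrPdist_le => e e0; near=> z.
have [lm _ _] : [/\ llim f z <= rlim f x + e, f z <= rlim f x + e &
    rlim f z <= rlim f x + e].
  by near: z; apply: (near_right_lt rf Ix); rewrite ltrDl.
have [ml _ _] : [/\ rlim f x - e <= llim f z, rlim f x - e <= f z &
    rlim f x - e <= rlim f z].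
  by near: z; apply: (near_right_gt rf Ix); rewrite ltrBlDr ltrDl.
by rewrite ler_norml; apply/andP; split; lra.
Unshelve. all: by end_near. Qed.

Lemma cvg_rlim_left a b f x : regulated (oitv a b) f -> oitv a b x ->
  rlim f z @[z --> x^'-] --> llim f x.
Proof.
move=> rf Ix; apply/cvgrPdist_le => e e0; near=> z.
have [_ _ lm] : [/\ llim f z <= llim f x + e, f z <= llim f x + e &
    rlim f z <= llim f x + e].
  by near: z; apply: (near_left_lt rf Ix); rewrite ltrDl.
have [_ _ ml] : [/\ llim f x - e <= llim f z, llim f x - e <= f z &
    llim f x - e <= rlim f z].
  by near: z; apply: (near_left_gt rf Ix); rewrite ltrBlDr ltrDl.
by rewrite ler_norml; apply/andP; split; lra.
Unshelve. all: by end_near. Qed.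

Lemma limr_norm_le (F : set_system R) f M l : ProperFilter F ->
  f z @[z --> F] --> l -> (\forall z \near F, `|f z| <= M) -> `|l| <= M.
Proof.
move=> PF fl fM; have nl : `|f z| @[z --> F] --> `|l| by exact: cvg_norm.
by rewrite -(cvg_lim _ nl)//; apply: limr_le => //; exact: (cvgP `|l|).
Qed.

End OneSidedLimits.

(** * Functions of bounded variation and their charges *)

Section BoundedVariation.
Context {R : realType}.
Implicit Types (a b : \bar R) (x y z s t c d k l m e M : R) (f g h p q : R -> R).

(** Clipping the argument to [c, d] makes the two variation functions monotone on the whole line,
    where the results on nondecreasing functions apply. *)
Lemma bounded_variation_nd_sub c d f : c <= d -> bounded_variation c d f ->
  exists p q, [/\ nondecreasing p, nondecreasing q &
    {in `[c, d], f =1 p \- q}].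
Proof.
move=> cd bvf; pose clip x := Num.max c (Num.min x d).
have clipP x : clip x \in `[c, d].
  by rewrite in_itv/= le_max lexx/= ge_max cd/= ge_min lexx orbT.
have clip_nd : nondecreasing clip.
  by move=> x y xy; rewrite ge_max !le_max lexx/= le_min !ge_min xy lexx !orbT.
have nd h : {in `[c, d] &, nondecreasing h} -> nondecreasing (h \o clip).
  by move=> ndh x y xy /=; apply: ndh => //; exact: clip_nd.
exists ((fine \o pos_tv c f) \o clip), ((fine \o neg_tv c f) \o clip); split.
- by apply: nd; apply: fine_neg_tv_nondecreasing; exact: bounded_variationN.
- by apply: nd; exact: fine_neg_tv_nondecreasing.
- move=> x xcd; rewrite (bounded_variation_pos_neg_tvE bvf)//=.
  move: (xcd); rewrite in_itv/= => /andP[cx xd].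
  by have -> : clip x = x by rewrite /clip (min_l xd) (max_r cx).
Qed.

Lemma bounded_variation_measurable c d f : c <= d -> bounded_variation c d f ->
  measurable_fun `]c, d[ (f : measurableTypeR R -> measurableTypeR R).
Proof.
move=> cd /bounded_variation_nd_sub[]// p [q [ndp ndq fpq]].
apply: (@eq_measurable_fun _ _ _ _ _ (p \- q)).
  by move=> x; rewrite inE => /= xcd; rewrite fpq//; exact: subset_itv_oo_cc xcd.
by apply: measurable_funB; exact: nondecreasing_measurable.
Qed.

Lemma bounded_variation_bounded c d f : c <= d -> bounded_variation c d f ->
  exists M, forall x, c < x < d -> `|f x| <= M.
Proof.
move=> cd /bounded_variation_nd_sub[]// p [q [ndp ndq fpq]].
exists (`|p c| + `|p d| + (`|q c| + `|q d|)) => x /andP[cx xd].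
rewrite fpq; last by rewrite in_itv/= !ltW.
have H h : nondecreasing h -> `|h x| <= `|h c| + `|h d|.
  move=> ndh; have /ndh h1 := ltW cx; have /ndh h2 := ltW xd.
  rewrite ler_norml; apply/andP; split.
    by have := ler_norm (- h c); have := normr_ge0 (h d); rewrite normrN; lra.
  by have := ler_norm (h d); have := normr_ge0 (h c); lra.
by apply: (le_trans (ler_normB _ _)); rewrite lerD// H.
Qed.

Lemma BVloc_regulated a b f : BVloc a b f -> regulated (oitv a b) f.
Proof.
move=> bvf x /oitv_oo[c [d [Ic Id cxd]]]; have /andP[cx xd] := cxd.
have cd := lt_trans cx xd.
have [p [q [ndp ndq fpq]]] := bounded_variation_nd_sub (ltW cd) (bvf _ _ Ic Id cd).
have [eqL eqR] := @near_oo _ c d (fun z => p z - q z = f z) x cxd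
  (fun z => ltac:(by move=> /andP[cz zd]; rewrite fpq// in_itv/= !ltW)).
have L : f z @[z --> x^'-] --> llim p x - llim q x.
  by apply: cvg_trans (near_eq_cvg eqL) _; apply: cvgB; exact: nd_cvg_llim.
have Q : f z @[z --> x^'+] --> rlim p x - rlim q x.
  by apply: cvg_trans (near_eq_cvg eqR) _; apply: cvgB; exact: nd_cvg_rlim.
by rewrite (llim_eq L) (rlim_eq Q).
Qed.

Lemma cvg_right_seq (F : R -> R) x l d : 0 < d -> F z @[z --> x^'+] --> l ->
  (F (x + d / n.+2%:R)) @[n --> \oo] --> l.
Proof.
move=> d0 /cvg_at_rightP; apply; split=> [n|]; first by rewrite ltrDl divr_gt0.
rewrite -[X in _ --> X]addr0; apply: cvgD; first exact: cvg_cst.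
apply/cvgrPdist_lt => e e0; have ed0 : 0 < e / d by rewrite divr_gt0.
near=> n; rewrite sub0r normrN gtr0_norm ?divr_gt0// ltr_pdivrMr// -ltr_pdivrMl//.
apply: lt_le_trans (_ : n.+1%:R <= _); last by rewrite ler_nat.
suff : n.+1%:R^-1 < e / d by rewrite -ltf_pV2 ?posrE// invrK invf_div mulrC.
by near: n; exact: near_infty_natSinv_lt (PosNum ed0).
Unshelve. all: by end_near. Qed.

End BoundedVariation.

Section GeneratedCharges.
Context {R : realType}.
Implicit Types (a b : \bar R) (x y z s t c d k l m e M : R) (f g h p q : R -> R).
Implicit Types (A : set (measurableTypeR R)).
Implicit Type nu : {charge set (measurableTypeR R) -> \bar R}.

(** The open interval is the increasing union of intervals [w, z[ with w decreasing to x. The charge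
    is continuous along it, and the left limits of f at w tend to the right limit at x. *)
Lemma generates_oo a b f c d nu : regulated (oitv a b) f ->
  oitv a b c -> oitv a b d -> generates c d f nu ->
  forall x z, c < x -> x < z -> z < d ->
  nu `]x, z[%classic = (llim f z - rlim f x)%:E.
Proof.
move=> rf Ic Id [_ gen] x z cx xz zd.
have Ix : oitv a b x.
  by apply: (oitv_between Ic Id); rewrite !ltW// (lt_trans xz).
have zx0 : 0 < z - x by rewrite subr_gt0.
(* The denominator starts at 2, so that already the first term lies strictly below z. *)
pose w n := x + (z - x) / n.+2%:R.
have xw n : x < w n by rewrite ltrDl divr_gt0.
have wz n : w n < z.
  by rewrite -ltrBrDl ltr_pdivrMr// ltr_pMr// ltr1n.
have w_lim h l : h t @[t --> x^'+] --> l -> h (w n) @[n --> \oo] --> l.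
  exact: cvg_right_seq.
have w_cvg : w n @[n --> \oo] --> x.
  by apply: (w_lim id); apply: cvg_within_filter; exact: cvg_id.
pose F n := `[w n, z[%classic.
have H : nu (F n) @[n --> \oo] --> nu `]x, z[%classic.
  apply: charge_cvg => [n|n m nm|].
  - exact: measurable_itv.
  - apply/subsetPset => t; rewrite /F /= !in_itv/= => /andP[+ ->].
    rewrite andbT; apply: le_trans; rewrite lerD2l ler_wpM2l ?(ltW zx0)//.
    by rewrite lef_pV2 ?posrE// ler_nat.
  - apply/seteqP; split=> [t [n _]|t]; rewrite /F /= !in_itv/= => /andP[wt tz].
      by rewrite tz (lt_le_trans (xw n)).
    have [n _ /(_ n (leqnn n))] := cvgr_lt _ w_cvg _ wt.
    by move=> wnt; exists n => //; rewrite /F /= in_itv/= tz ltW.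
apply: (cvg_unique _ H); first exact: ereal_hausdorff.
rewrite (_ : (fun n => nu (F n)) = EFin \o (fun n => llim f z - llim f (w n))).
  apply: cvg_EFin; first by near=> n.
  apply: cvgB; first exact: cvg_cst.
  exact/w_lim/cvg_llim_right/Ix.
by apply/funext => n; rewrite gen ?(lt_trans cx)//.
Unshelve. all: by end_near. Qed.

Lemma generates_set1 a b f c d nu : regulated (oitv a b) f ->
  oitv a b c -> oitv a b d -> generates c d f nu ->
  forall x, c < x < d -> nu [set x] = (jump f x)%:E.
Proof.
move=> rf Ic Id gen x /andP[cx xd].
have xz : x < (x + d) / 2 by rewrite midf_lt.
have zd : (x + d) / 2 < d by rewrite midf_lt.
have := generates_oo rf Ic Id gen cx xz zd.
have := gen.2 _ _ cx xz zd.
rewrite -(@setU1itv _ _ _ _ false) ?bnd_simp// chargeU//; last first.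
  by apply/seteqP; split=> // z [/= ->]; rewrite in_itv/= ltxx.
move=> + E2; rewrite [X in (_ + X)%E]E2 => E1.
have -> : nu [set x] = ((nu [set x] +
    (llim f ((x + d) / 2) - rlim f x)%:E) -
    (llim f ((x + d) / 2) - rlim f x)%:E)%E by rewrite addeK.
by rewrite E1 -EFinB; congr (_%:E); rewrite /jump; ring.
Qed.

(** [dmeas] is obtained by choice, so its sign cannot be read off its construction. By
    [generates_unique] any generating charge equals the restricted Lebesgue-Stieltjes measure of the
    clipped function, which is nonnegative. *)
Lemma generates_nd_ge0 c d f nu : c < d ->
  {in `[c, d] &, nondecreasing f} -> generates c d f nu ->
  forall A, measurable A -> (0 <= nu A)%E.
Proof.
move=> cd ndf gen A mA.
pose h x := f (Num.max c (Num.min x d)).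
have ndh : nondecreasing h.
  have clipP x : Num.max c (Num.min x d) \in `[c, d].
    by rewrite in_itv/= le_max lexx/= ge_max (ltW cd)/= ge_min lexx orbT.
  move=> x y xy; apply: ndf => //.
  by rewrite ge_max !le_max lexx/= le_min !ge_min xy lexx !orbT.
pose G : cumulative R R := HB.pack (rlim h)
  (isCumulative.Build R _ R (rlim h) (nd_rlim_nd ndh) (nd_rlim_rc ndh)).
pose mu := mrestr (lebesgue_stieltjes_measure G) (measurable_itv `]c, d[).
have mufin : fin_num_fun mu.
  move=> B mB; rewrite ge0_fin_numE//.
  rewrite (@le_lt_trans _ _ (lebesgue_stieltjes_measure G `]c, d]%classic))//.
    apply: le_measure; rewrite ?inE//; first exact: measurableI.
    by move=> x [_ /=]; rewrite !in_itv/= => /andP[-> /ltW].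
  by rewrite lsm_itvoc ?ltW// ltry.
pose mu' : {finite_measure set (measurableTypeR R) -> \bar R} :=
  HB.pack mu (Measure_isFinite.Build _ _ _ mu mufin).
rewrite (generates_unique (nu2 := charge_of_finite_measure mu') cd gen)//.
split=> [B mB|x y cx xy yd].
  by rewrite /charge_of_finite_measure/= /mu /mrestr -setIA setIid.
rewrite /charge_of_finite_measure/= /mu /mrestr setIidl; last first.
  move=> t /=; rewrite !in_itv/= => /andP[xt ty].
  by rewrite (lt_le_trans cx)// (lt_trans ty).
have llimE z : c < z -> z < d -> llim h z = llim f z.
  move=> cz zd; apply: (llim_near_eq cz) => t; rewrite in_itv/= => /andP[ct tz].
  by rewrite /h min_l ?max_r ?ltW// (lt_trans tz).
by rewrite (@lsm_itvco _ G h)// !llimE// ?(lt_trans cx)// (lt_trans xy).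
Qed.

Lemma jneg_eq0 nu A : (forall B, measurable B -> (0 <= nu B)%E) ->
  measurable A -> jneg nu A = 0%E.
Proof.
move=> nu0 mA; apply/eqP; rewrite eq_le measure_ge0 andbT.
rewrite -[leLHS]/(jordan_neg (hahn_setsP nu) A) jordan_negE cjordan_negE leeNl oppe0.
by rewrite /crestr0 mem_set// /crestr nu0//; apply: measurableI => //;
   case: (hahn_setsP nu) => _ [].
Qed.

End GeneratedCharges.

(** * Integrals with respect to a charge *)

Section DensityIntegrals.
Context {R : realType}.
Implicit Types (a b : \bar R) (x y z s t c d k l m e M : R) (f g h p q : R -> R).
Implicit Types (A B : set (measurableTypeR R)).
Implicit Type nu : {charge set (measurableTypeR R) -> \bar R}.
Implicit Type mu : {finite_measure set (measurableTypeR R) -> \bar R}.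

Definition bounded_measurable A h :=
  measurable_fun A (h : measurableTypeR R -> measurableTypeR R) /\
  exists M, forall x, A x -> `|h x| <= M.

Lemma bounded_measurableS A B h : measurable B -> A `<=` B ->
  bounded_measurable B h -> bounded_measurable A h.
Proof.
move=> mB AB [mh [M hM]]; split; first exact: measurable_funS mh.
by exists M => x /AB; exact: hM.
Qed.

Lemma bounded_measurableZ A h k : bounded_measurable A h ->
  bounded_measurable A (fun x => k * h x).
Proof.
move=> [mh [M hM]]; split; first exact: measurable_funM.
by exists (`|k| * M) => x Ax; rewrite normrM ler_wpM2l// hM.
Qed.

Lemma bounded_measurable_lin A h g k l : bounded_measurable A h ->
  bounded_measurable A g ->
  bounded_measurable A (fun x => k * h x + l * g x).
Proof.
move=> /(bounded_measurableZ k)[mh [M hM]] /(bounded_measurableZ l)[mg [N gN]].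
split; first exact: measurable_funD.
exists (M + N) => x Ax; apply: le_trans (ler_normD _ _) _.
by rewrite lerD// ?hM// gN.
Qed.

Lemma bounded_measurable_integrable mu A h : measurable A ->
  bounded_measurable A h -> mu.-integrable A (EFin \o h).
Proof.
move=> mA [mh [M hM]]; apply: measurable_bounded_integrable => //.
  by rewrite -ge0_fin_numE// fin_num_measure.
exists M; split; first exact: num_real.
by move=> N MN x Ax; apply: le_trans (ltW MN); exact: hM.
Qed.

Definition dint nu h A : R :=
  \int[jpos nu]_(x in A) h x - \int[jneg nu]_(x in A) h x.

(** The total variation of [nu] on [A]. *)
Definition var nu A : R := fine (jpos nu A) + fine (jneg nu A).

Lemma densityE nu h A : measurable A -> bounded_measurable A h ->
  density nu h A = (dint nu h A)%:E.
Proof.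
move=> mA bh; rewrite /density /dint EFinB /Rintegral !fineK//;
  by apply: integrable_fin_num => //; exact: bounded_measurable_integrable.
Qed.

Lemma dint_lin nu h g k l A : measurable A -> bounded_measurable A h ->
  bounded_measurable A g ->
  dint nu (fun x => k * h x + l * g x) A = k * dint nu h A + l * dint nu g A.
Proof.
move=> mA bh bg.
have H mu : \int[mu]_(x in A) (k * h x + l * g x) =
    k * \int[mu]_(x in A) h x + l * \int[mu]_(x in A) g x.
  have ih := bounded_measurable_integrable mu mA bh.
  have ig := bounded_measurable_integrable mu mA bg.
  rewrite RintegralD ?RintegralZl//; apply: bounded_measurable_integrable => //;
    exact: bounded_measurableZ.
by rewrite /dint !H; ring.
Qed.

Lemma le_norm_Rintegral mu h A M : measurable A -> bounded_measurable A h ->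
  (forall x, A x -> `|h x| <= M) ->
  `|\int[mu]_(x in A) h x| <= M * fine (mu A).
Proof.
move=> mA bh hM; have ih := bounded_measurable_integrable mu mA bh.
apply: le_trans (le_normr_Rintegral mA ih) _.
rewrite -Rintegral_cst//; apply: le_Rintegral => //; first exact: integrable_norm.
apply: bounded_measurable_integrable => //; split; first exact: measurable_cst.
by exists `|M|.
Qed.

Lemma dint_le nu h A M : measurable A -> bounded_measurable A h ->
  (forall x, A x -> `|h x| <= M) -> `|dint nu h A| <= M * var nu A.
Proof.
move=> mA bh hM; apply: le_trans (ler_normB _ _) _.
by rewrite mulrDr lerD// le_norm_Rintegral.
Qed.

Lemma dint_ge nu h A m : (forall B, measurable B -> (0 <= nu B)%E) ->
  measurable A -> bounded_measurable A h -> (forall x, A x -> m <= h x) ->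
  m * fine (nu A) <= dint nu h A.
Proof.
move=> nu0 mA bh hm; have [_ [M hM]] := bh.
have : `|\int[jneg nu]_(x in A) h x| <= 0.
  by apply: le_trans (le_norm_Rintegral _ mA bh hM) _; rewrite jneg_eq0// mulr0.
rewrite normr_le0 => /eqP; rewrite /dint => ->.
rewrite subr0 jordanE// jneg_eq0// sube0.
rewrite -Rintegral_cst//; apply: le_Rintegral => //.
  apply: bounded_measurable_integrable => //; split; first exact: measurable_cst.
  by exists `|m|.
exact: bounded_measurable_integrable.
Qed.

Lemma dint_set1 nu h x : dint nu h [set x] = h x * fine (nu [set x]).
Proof.
have mx : measurable ([set x] : set (measurableTypeR R)).
  exact: measurable_set1.
have H mu : \int[mu]_(y in [set x]) h y = h x * fine (mu [set x]).
  rewrite -Rintegral_cst//.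
  by apply: eq_Rintegral => y; rewrite inE => ->.
by rewrite /dint !H -mulrBr jordanE// fineB// fin_num_measure.
Qed.

(** Continuity from above along intervals ]x, x + 1/(n+1)[ with empty intersection. Leaving out x
    makes the mass small even when x is an atom. *)
Lemma fine_measure_oo_right mu x e : 0 < e ->
  \forall z \near x^'+, fine (mu `]x, z[%classic) <= e.
Proof.
move=> e0; pose F n := `]x, x + n.+1%:R^-1[%classic : set (measurableTypeR R).
have F0 : \bigcap_n F n = set0.
  apply/seteqP; split=> // t Ft; have := Ft 0%N I.
  rewrite /F /= in_itv/= => /andP[xt _].
  have xt0 : 0 < t - x by rewrite subr_gt0.
  have [n _ /(_ n (leqnn n)) /= nt] := near_infty_natSinv_lt (PosNum xt0).
  have := Ft n I; rewrite /F /= in_itv/= => /andP[_].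
  by rewrite -ltrBlDl ltNge (ltW nt).
have : mu (F n) @[n --> \oo] --> 0%E.
  rewrite -(measure0 mu) -F0; apply: nonincreasing_cvg_mu.
  - by rewrite -ge0_fin_numE// fin_num_measure//; exact: measurable_itv.
  - by move=> n; exact: measurable_itv.
  - by rewrite F0; exact: measurable0.
  - move=> n m nm; apply/subsetPset; apply: subset_itvl.
    by rewrite bnd_simp lerD2l lef_pV2 ?posrE// ler_nat.
move=> /fine_cvgP[_] /cvgr_le /(_ e e0)[n _ /(_ n (leqnn n)) /= Fe].
near=> z; apply: le_trans Fe; apply: fine_le.
- by rewrite fin_num_measure//; exact: measurable_itv.
- by rewrite fin_num_measure//; exact: measurable_itv.
- apply: le_measure; rewrite ?inE; [exact: measurable_itv..|].
  apply: subset_itvl; rewrite bnd_simp; near: z.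
  by apply: nbhs_right_le; rewrite ltrDl.
Unshelve. all: by end_near. Qed.

Lemma fine_measure_oo_left mu x e : 0 < e ->
  \forall z \near x^'-, fine (mu `]z, x[%classic) <= e.
Proof.
move=> e0; pose F n := `]x - n.+1%:R^-1, x[%classic : set (measurableTypeR R).
have F0 : \bigcap_n F n = set0.
  apply/seteqP; split=> // t Ft; have := Ft 0%N I.
  rewrite /F /= in_itv/= => /andP[_ xt].
  have xt0 : 0 < x - t by rewrite subr_gt0.
  have [n _ /(_ n (leqnn n)) /= nt] := near_infty_natSinv_lt (PosNum xt0).
  have := Ft n I; rewrite /F /= in_itv/= => /andP[+ _].
  by rewrite ltrBlDl -ltrBlDr ltNge (ltW nt).
have : mu (F n) @[n --> \oo] --> 0%E.
  rewrite -(measure0 mu) -F0; apply: nonincreasing_cvg_mu.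
  - by rewrite -ge0_fin_numE// fin_num_measure//; exact: measurable_itv.
  - by move=> n; exact: measurable_itv.
  - by rewrite F0; exact: measurable0.
  - move=> n m nm; apply/subsetPset; apply: subset_itvr.
    by rewrite bnd_simp lerD2l lerN2 lef_pV2 ?posrE// ler_nat.
move=> /fine_cvgP[_] /cvgr_le /(_ e e0)[n _ /(_ n (leqnn n)) /= Fe].
near=> z; apply: le_trans Fe; apply: fine_le.
- by rewrite fin_num_measure//; exact: measurable_itv.
- by rewrite fin_num_measure//; exact: measurable_itv.
- apply: le_measure; rewrite ?inE; [exact: measurable_itv..|].
  apply: subset_itvr; rewrite bnd_simp; near: z.
  by apply: nbhs_left_ge; rewrite ltrBlDr ltrDl.
Unshelve. all: by end_near. Qed.

Lemma var_oo_right nu x e : 0 < e -> \forall z \near x^'+, var nu `]x, z[ <= e.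
Proof.
move=> e0; have e20 : 0 < e / 2 by rewrite divr_gt0.
near=> z; rewrite (splitr e) /var lerD//; near: z;
  exact: fine_measure_oo_right.
Unshelve. all: by end_near. Qed.

Lemma var_oo_left nu x e : 0 < e -> \forall z \near x^'-, var nu `]z, x[ <= e.
Proof.
move=> e0; have e20 : 0 < e / 2 by rewrite divr_gt0.
near=> z; rewrite (splitr e) /var lerD//; near: z;
  exact: fine_measure_oo_left.
Unshelve. all: by end_near. Qed.

Lemma le_var nu A B : measurable A -> measurable B -> A `<=` B ->
  var nu A <= var nu B.
Proof.
move=> mA mB AB; rewrite /var lerD// fine_le ?fin_num_measure//;
  by apply: le_measure; rewrite ?inE.
Qed.

End DensityIntegrals.

(** * Solution pairs *)

Section Solutions.
Context {R : realType} (a b : \bar R) (r : R) (alpha beta : R -> R).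
Implicit Types (x y z s t c d k l m e M : R) (f g h p q u v w : R -> R).

(* f is r-balanced and df = h dmu; only the values of the two measures at atoms
   and open intervals are recorded. *)
Definition integral_of (mu f h : R -> R) :=
  [/\ regulated (oitv a b) f,
    forall x, oitv a b x -> f x = r * llim f x + (1 - r) * rlim f x,
    forall c d, oitv a b c -> oitv a b d -> c < d ->
      bounded_measurable `]c, d[ f,
    forall x, oitv a b x -> jump f x = h x * jump mu x &
    forall c d, oitv a b c -> oitv a b d ->
      forall x z, c < x -> x < z -> z < d ->
      llim f z - rlim f x = dint (dmeas c d mu) h `]x, z[].

(** The equation as a first-order system du = g dalpha, dg = u dbeta. Both halves have the same
    form, so each fact about [integral_of] serves twice. *)
Definition solution_pair u g := integral_of alpha u g /\ integral_of beta g u.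

Lemma BVloc_bounded_measurable f c d : BVloc a b f ->
  oitv a b c -> oitv a b d -> c < d -> bounded_measurable `]c, d[ f.
Proof.
move=> bvf Ic Id cd; have bv := bvf _ _ Ic Id cd; split.
  exact: bounded_variation_measurable (ltW cd) bv.
have [M fM] := bounded_variation_bounded (ltW cd) bv.
by exists M => x /=; rewrite in_itv/=; exact: fM.
Qed.

Lemma integral_of_density mu f h :
  BVloc a b mu -> balanced r a b f -> BVloc a b h ->
  (forall c d, oitv a b c -> oitv a b d -> c < d ->
    forall A, measurable A -> A `<=` `]c, d[ ->
      dmeas c d f A = density (dmeas c d mu) h A) ->
  integral_of mu f h.
Proof.
move=> bvmu [bvf balf] bvh dens.
have rf := BVloc_regulated bvf; have rmu := BVloc_regulated bvmu.
split=> // [c d Ic Id cd|x Ix|c d Ic Id x z cx xz zd].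
- exact: BVloc_bounded_measurable.
- have [c [d [Ic Id cxd]]] := oitv_oo Ix; have /andP[cx xd] := cxd.
  have cd := lt_trans cx xd.
  have mx : measurable ([set x] : set (measurableTypeR R)).
    exact: measurable_set1.
  have sub : [set x] `<=` `]c, d[ by move=> _ ->; rewrite /= in_itv/= cx.
  have := dens _ _ Ic Id cd _ mx sub.
  rewrite densityE//; last first.
    by apply: bounded_measurableS sub _ => //; exact: BVloc_bounded_measurable.
  rewrite dint_set1.
  rewrite (generates_set1 rf Ic Id (dmeasP cd (bvf _ _ Ic Id cd)) cxd).
  rewrite (generates_set1 rmu Ic Id (dmeasP cd (bvmu _ _ Ic Id cd)) cxd).
  by case.
- have cd := lt_trans cx (lt_trans xz zd).
  have sub : `]x, z[ `<=` `]c, d[%classic.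
    by apply: subset_itvW; exact: ltW.
  have mI : measurable (`]x, z[%classic : set (measurableTypeR R)).
    exact: measurable_itv.
  have := dens _ _ Ic Id cd _ mI sub.
  rewrite densityE//; last first.
    by apply: bounded_measurableS sub _ => //; exact: BVloc_bounded_measurable.
  have gen := dmeasP cd (bvf _ _ Ic Id cd).
  by rewrite (generates_oo rf Ic Id gen cx xz zd) => -[].
Qed.

Lemma integral_of_lin mu f1 h1 f2 h2 k l :
  (forall c d, oitv a b c -> oitv a b d -> c < d ->
    bounded_measurable `]c, d[ h1) ->
  (forall c d, oitv a b c -> oitv a b d -> c < d ->
    bounded_measurable `]c, d[ h2) ->
  integral_of mu f1 h1 -> integral_of mu f2 h2 ->
  integral_of mu (fun x => k * f1 x + l * f2 x) (fun x => k * h1 x + l * h2 x).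
Proof.
move=> bh1 bh2 [r1 bal1 bm1 j1 int1] [r2 bal2 bm2 j2 int2].
have [rD limD] := regulated_lin k l r1 r2.
split=> // [x Ix|c d Ic Id cd|x Ix|c d Ic Id x z cx xz zd].
- by have [-> ->] := limD _ Ix; rewrite bal1// bal2//; ring.
- by apply: bounded_measurable_lin; [exact: bm1|exact: bm2].
- have [E1 E2] := limD _ Ix; rewrite /jump E1 E2.
  have := j1 _ Ix; have := j2 _ Ix; rewrite /jump => J2 J1.
  rewrite (_ : _ - _ = k * (rlim f1 x - llim f1 x) +
    l * (rlim f2 x - llim f2 x)); last by ring.
  by rewrite J1 J2; ring.
- have cd := lt_trans cx (lt_trans xz zd).
  have Ix : oitv a b x.
    by apply: (oitv_between Ic Id); rewrite !ltW// (lt_trans xz).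
  have Iz : oitv a b z.
    by apply: (oitv_between Ic Id); rewrite !ltW// (lt_trans cx).
  have sub : `]x, z[ `<=` `]c, d[%classic.
    by apply: subset_itvW; exact: ltW.
  have bS h : bounded_measurable `]c, d[ h -> bounded_measurable `]x, z[ h.
    by apply: bounded_measurableS => //; exact: measurable_itv.
  rewrite dint_lin; [|exact: measurable_itv|exact/bS/bh1|exact/bS/bh2].
  rewrite -int1// -int2//.
  by rewrite (limD _ Ix).2 (limD _ Iz).1; ring.
Qed.

Lemma solution_pair_lin u1 g1 u2 g2 k l :
  solution_pair u1 g1 -> solution_pair u2 g2 ->
  solution_pair (fun x => k * u1 x + l * u2 x) (fun x => k * g1 x + l * g2 x).
Proof.
move=> [iu1 ig1] [iu2 ig2]; have [_ _ bu1 _ _] := iu1.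
have [_ _ bg1 _ _] := ig1; have [_ _ bu2 _ _] := iu2; have [_ _ bg2 _ _] := ig2.
by split; exact: integral_of_lin.
Qed.

Hypothesis alpha_incr : forall x y, oitv a b x -> oitv a b y -> x < y ->
  alpha x < alpha y.
Hypothesis BVbeta : BVloc a b beta.

Lemma alpha_nd c d : oitv a b c -> oitv a b d ->
  {in `[c, d] &, nondecreasing alpha}.
Proof.
move=> Ic Id x y; rewrite !in_itv/= => xcd ycd.
rewrite le_eqVlt => /orP[/eqP -> //|xy].
by apply/ltW/alpha_incr => //; exact: (oitv_between Ic Id).
Qed.

Lemma BValpha : BVloc a b alpha.
Proof.
by move=> c d Ic Id _; apply: nondecreasing_bounded_variation; exact: alpha_nd.
Qed.

Lemma balanced_solution_pair u : balanced_solution r a b alpha beta u ->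
  exists g, solution_pair u g.
Proof.
move=> [balu [g [balg rn eqn]]]; exists g; split.
  apply: integral_of_density => //; first exact: BValpha.
    by case: balg.
  by move=> c d Ic Id cd A mA Acd; have [_] := rn _ _ Ic Id cd; exact.
apply: integral_of_density => //; first by case: balu.
move=> c d Ic Id cd A mA Acd; have := eqn _ _ Ic Id cd _ mA Acd.
rewrite densityE//; last first.
  apply: bounded_measurableS Acd _; first exact: measurable_itv.
  by apply: BVloc_bounded_measurable => //; case: balu.
have : dmeas c d g A \is a fin_num by exact: fin_num_measure.
case: (dmeas c d g A) => // x _ /eqP.
by rewrite -EFinN -EFinD eqe addrC subr_eq0 => /eqP ->.
Qed.

Lemma jump_alpha_ge0 x : oitv a b x -> 0 <= jump alpha x.
Proof.
move=> Ix; rewrite subr_ge0.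
have [la ra] := BVloc_regulated BValpha Ix.
have [In Ip] := oitv_near Ix.
have: llim alpha x <= alpha x.
  apply: limr_le; first exact: (cvgP _ la).
  near=> z; have Iz : oitv a b z by near: z.
  by apply/ltW/alpha_incr => //; near: z; exact: nbhs_left_lt.
move=> /le_trans; apply; apply: limr_ge; first exact: (cvgP _ ra).
near=> z; have Iz : oitv a b z by near: z.
by apply/ltW/alpha_incr => //; near: z; exact: nbhs_right_gt.
Unshelve. all: by end_near. Qed.

Lemma alpha_lims_lt x z : oitv a b x -> oitv a b z -> x < z ->
  rlim alpha x < llim alpha z.
Proof.
move=> Ix Iz xz.
have mid (p q : R) : p < q -> exists2 w, p < w & w < q.
  by move=> pq; exists ((p + q) / 2); rewrite midf_lt.
(* Passing to one-sided limits keeps only weak inequalities; strictness comes from alpha w1 < alpha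
   w2 at two intermediate points. *)
have [w1 xw1 w1z] := mid _ _ xz; have [w2 w12 w2z] := mid _ _ w1z.
have I1 : oitv a b w1 by apply: (oitv_between Ix Iz); rewrite !ltW.
have I2 : oitv a b w2.
  by apply: (oitv_between Ix Iz); rewrite (ltW w2z) (ltW (lt_trans xw1 w12)).
have [_ ra] := BVloc_regulated BValpha Ix.
have [la _] := BVloc_regulated BValpha Iz.
apply: (@le_lt_trans _ _ (alpha w1)).
  apply: limr_le; first exact: (cvgP _ ra).
  near=> y; have Iy : oitv a b y by near: y; have [] := oitv_near Ix.
  by apply/ltW/alpha_incr => //; near: y; exact: nbhs_right_lt.
apply: (lt_le_trans (alpha_incr I1 I2 w12)).
apply: limr_ge; first exact: (cvgP _ la).
near=> y; have Iy : oitv a b y by near: y; have [] := oitv_near Iz.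
by apply/ltW/alpha_incr => //; near: y; exact: nbhs_left_gt.
Unshelve. all: by end_near. Qed.

(** A strictly increasing alpha gives every nonempty open interval positive mass, so a density
    bounded below by m > 0 forces a strict increase of f. *)
Lemma integral_alpha_gt0 f h m x z : 0 < m -> integral_of alpha f h ->
  (forall c d, oitv a b c -> oitv a b d -> c < d ->
    bounded_measurable `]c, d[ h) ->
  oitv a b x -> oitv a b z -> x < z -> (forall y, x < y < z -> m <= h y) ->
  rlim f x < llim f z.
Proof.
move=> m0 [_ _ _ _ int] bh Ix Iz xz hm.
have [c [_ [Ic _ /andP[cx _]]]] := oitv_oo Ix.
have [_ [d [_ Id /andP[_ zd]]]] := oitv_oo Iz.
have cd : c < d by rewrite (lt_trans cx)// (lt_trans xz).
have gen := dmeasP cd (BValpha Ic Id cd).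
have sub : `]x, z[ `<=` `]c, d[%classic by apply: subset_itvW; exact: ltW.
rewrite -subr_gt0 (int c d)//.
apply: lt_le_trans (dint_ge (m := m) _ _ _ _).
- rewrite (generates_oo (BVloc_regulated BValpha) Ic Id gen)//=.
  by rewrite mulr_gt0// subr_gt0; exact: alpha_lims_lt.
- by move=> B; apply: (generates_nd_ge0 cd (alpha_nd Ic Id) gen).
- exact: measurable_itv.
- by apply: bounded_measurableS sub (bh _ _ Ic Id cd); exact: measurable_itv.
- by move=> y /=; rewrite in_itv/=; exact: hm.
Qed.

End Solutions.

(** * Uniqueness for the initial value problem *)

Section LocalUniqueness.
Context {R : realType} (a b : \bar R) (r : R).
Implicit Types (x y z s t c d k l m e M : R) (f g h p q u v w mu : R -> R).
Hypothesis r01 : 0 <= r <= 1.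

(** For r in [0, 1] the balanced value is a convex combination of the one-sided limits. *)
Lemma balanced_le f x M : f x = r * llim f x + (1 - r) * rlim f x ->
  `|llim f x| <= M -> `|rlim f x| <= M -> `|f x| <= M.
Proof.
move=> -> lM rM; have /andP[r0 r1] := r01.
have r10 : 0 <= 1 - r by rewrite subr_ge0.
apply: le_trans (ler_normD _ _) _; rewrite !normrM (ger0_norm r0) (ger0_norm r10).
rewrite (_ : M = r * M + (1 - r) * M); last by ring.
by apply: lerD; apply: ler_wpM2l.
Qed.

(* Where dalpha and dbeta have mass at most 1/2, the integral equations with
   zero initial data halve any common bound on (u, du/dalpha); this contraction
   replaces Gronwall's inequality in the uniqueness proof. *)
Lemma integral_of_half_right mu f h c d x t M : integral_of a b r mu f h ->
  oitv a b c -> oitv a b d -> c < x -> t < d ->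
  bounded_measurable `]c, d[ h ->
  var (dmeas c d mu) `]x, t[ <= 2^-1 -> rlim f x = 0 ->
  (forall y, x < y < t -> `|h y| <= M) ->
  forall y, x < y < t -> `|f y| <= M / 2.
Proof.
move=> [rf balf _ _ int] Ic Id cx td bh var2 fx0 hM.
have Ixt y : x < y < t -> oitv a b y.
  move=> /andP[xy yt].
  by apply: (oitv_between Ic Id); rewrite !ltW ?(lt_trans cx)// (lt_trans yt).
have fl y : x < y < t -> `|llim f y| <= M / 2.
  move=> /andP[xy yt]; have yd := lt_trans yt td.
  rewrite -[llim f y]subr0 -fx0 (int c d)//.
  have sub : `]x, y[ `<=` `]c, d[%classic by apply: subset_itvW; exact: ltW.
  have M0 : 0 <= M by apply: le_trans (hM y _); rewrite ?xy.
  apply: le_trans (dint_le (M := M) _ _ _ _) _.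
  - exact: measurable_itv.
  - by apply: bounded_measurableS sub bh; exact: measurable_itv.
  - by move=> z /=; rewrite in_itv/= => /andP[xz zy]; rewrite hM// xz (lt_trans zy).
  - rewrite ler_wpM2l//; apply: le_trans var2; apply: le_var;
      [exact: measurable_itv..|].
    by apply: subset_itvW => //; exact: ltW.
(* The integral over ]x, y[ bounds only the left limit at y. The right limit inherits the bound as a
   limit of left limits at points beyond y. *)
move=> y yxt; apply: (balanced_le (balf _ (Ixt _ yxt)) (fl _ yxt)).
apply: limr_norm_le (cvg_llim_right rf (Ixt _ yxt)) _.
have [_] := near_oo yxt fl; exact.
Qed.

Lemma integral_of_half_left mu f h c d x t M : integral_of a b r mu f h ->
  oitv a b c -> oitv a b d -> c < t -> x < d ->
  bounded_measurable `]c, d[ h ->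
  var (dmeas c d mu) `]t, x[ <= 2^-1 -> llim f x = 0 ->
  (forall y, t < y < x -> `|h y| <= M) ->
  forall y, t < y < x -> `|f y| <= M / 2.
Proof.
move=> [rf balf _ _ int] Ic Id ct xd bh var2 fx0 hM.
have Itx y : t < y < x -> oitv a b y.
  move=> /andP[ty yx].
  by apply: (oitv_between Ic Id); rewrite !ltW ?(lt_trans ct)// (lt_trans yx).
have fr y : t < y < x -> `|rlim f y| <= M / 2.
  move=> /andP[ty yx]; have cy := lt_trans ct ty.
  rewrite -normrN -[- _]add0r -fx0 (int c d)//.
  have sub : `]y, x[ `<=` `]c, d[%classic by apply: subset_itvW; exact: ltW.
  have M0 : 0 <= M by apply: le_trans (hM y _); rewrite ?ty.
  apply: le_trans (dint_le (M := M) _ _ _ _) _.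
  - exact: measurable_itv.
  - by apply: bounded_measurableS sub bh; exact: measurable_itv.
  - by move=> z /=; rewrite in_itv/= => /andP[yz zx]; rewrite hM// zx (lt_trans ty).
  - rewrite ler_wpM2l//; apply: le_trans var2; apply: le_var;
      [exact: measurable_itv..|].
    by apply: subset_itvW => //; exact: ltW.
move=> y ytx; apply: (balanced_le (balf _ (Itx _ ytx))) (fr _ ytx).
apply: limr_norm_le (cvg_rlim_left rf (Itx _ ytx)) _.
by have [] := near_oo ytx fr.
Qed.

(** The supremum of max(|u|, |g|) over D is finite because of M0 and is itself a common bound. It is
    therefore at most half of itself, hence zero. *)
Lemma contraction_eq0 (D : set R) u g M0 :
  (forall x, D x -> `|u x| <= M0) -> (forall x, D x -> `|g x| <= M0) ->
  (forall M, (forall x, D x -> `|u x| <= M) -> (forall x, D x -> `|g x| <= M) ->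
    forall x, D x -> `|u x| <= M / 2 /\ `|g x| <= M / 2) ->
  forall x, D x -> u x = 0 /\ g x = 0.
Proof.
move=> uM gM half x Dx.
pose E := [set Num.max `|u y| `|g y| | y in D].
have E0 : E !=set0 by exists (Num.max `|u x| `|g x|); exists x.
have ubE : has_ubound E by exists M0 => _ [y Dy <-]; rewrite ge_max uM// gM.
have Esup y : D y -> `|u y| <= sup E /\ `|g y| <= sup E.
  move=> Dy; have : Num.max `|u y| `|g y| <= sup E.
    by apply: ub_le_sup => //; exists y.
  by rewrite ge_max => /andP.
have sup_half : sup E <= sup E / 2.
  apply: ge_sup => // _ [y Dy <-]; rewrite ge_max; apply/andP.
  by apply: half => // z /Esup[].
have [u_le g_le] := Esup _ Dx.
have u0 := normr_ge0 (u x); have g0 := normr_ge0 (g x).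
by split; apply/eqP; rewrite -normr_le0; lra.
Qed.

End LocalUniqueness.

Section SolutionPairs.
Context {R : realType} (a b : \bar R) (r : R) (alpha beta : R -> R).
Implicit Types (x y z s t c d k l m e M : R) (f g h p q u v w mu : R -> R).
Hypothesis r01 : 0 <= r <= 1.
Hypothesis alpha_incr : forall x y, oitv a b x -> oitv a b y -> x < y ->
  alpha x < alpha y.
Hypothesis theta1r : forall x, oitv a b x -> theta alpha beta (1 - r) x != 0.
Hypothesis thetar : forall x, oitv a b x -> theta alpha beta r x != 0.

Let pair u g := solution_pair a b r alpha beta u g.

(** Balance and the jump relation are two linear equations for the one-sided limits. As maps from (u
    x, g x) to the left and right data, the solutions have determinants theta_{1-r}(x) and
    theta_r(x). *)
Lemma solution_pair_lims u g x : pair u g -> oitv a b x ->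
  [/\ llim u x = u x - (1 - r) * jump alpha x * g x,
      rlim u x = u x + r * jump alpha x * g x,
      llim g x = g x - (1 - r) * jump beta x * u x &
      rlim g x = g x + r * jump beta x * u x].
Proof.
move=> [[_ balu _ ju _] [_ balg _ jg _]] Ix.
have lims f h (A : R) : f x = r * llim f x + (1 - r) * rlim f x ->
    jump f x = h x * A ->
    llim f x = f x - (1 - r) * A * h x /\ rlim f x = f x + r * A * h x.
  by move=> ef jf; rewrite -!mulrA (mulrC A) -jf ef /jump; split; ring.
by have [-> ->] := lims _ _ _ (balu _ Ix) (ju _ Ix);
   have [-> ->] := lims _ _ _ (balg _ Ix) (jg _ Ix).
Qed.

Lemma solution_pair_llim0 u g x : pair u g -> oitv a b x ->
  llim u x = 0 -> llim g x = 0 -> u x = 0 /\ g x = 0.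
Proof.
move=> ug Ix; have [-> _ -> _] := solution_pair_lims ug Ix.
move=> /eqP; rewrite subr_eq0 => /eqP u0 /eqP; rewrite subr_eq0 => /eqP g0.
split; apply: (mulfI (theta1r Ix)); rewrite /theta mulr0 mulrBl mul1r.
  by rewrite {1}u0 g0; ring.
by rewrite {1}g0 u0; ring.
Qed.

Lemma solution_pair_rlim0 u g x : pair u g -> oitv a b x ->
  rlim u x = 0 -> rlim g x = 0 -> u x = 0 /\ g x = 0.
Proof.
move=> ug Ix; have [_ -> _ ->] := solution_pair_lims ug Ix.
move=> /eqP; rewrite addr_eq0 => /eqP u0 /eqP; rewrite addr_eq0 => /eqP g0.
split; apply: (mulfI (thetar Ix)); rewrite /theta mulr0 mulrBl mul1r.
  by rewrite {1}u0 g0; ring.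
by rewrite {1}g0 u0; ring.
Qed.

Lemma solution_pair_bounded u g c d : pair u g -> oitv a b c -> oitv a b d ->
  c < d -> exists M, forall x, c < x < d -> `|u x| <= M /\ `|g x| <= M.
Proof.
move=> [[_ _ bu _ _] [_ _ bg _ _]] Ic Id cd.
have [_ [M uM]] := bu _ _ Ic Id cd; have [_ [N gN]] := bg _ _ Ic Id cd.
exists (Num.max M N) => x xcd; split; rewrite le_max.
  by rewrite uM//= in_itv.
by rewrite gN ?orbT//= in_itv.
Qed.

Lemma solution_pair_zero_right u g x : pair u g -> oitv a b x ->
  u x = 0 -> g x = 0 -> \forall z \near x^'+, u z = 0 /\ g z = 0.
Proof.
move=> ug Ix u0 g0; have [_ ru _ rg] := solution_pair_lims ug Ix.
rewrite u0 g0 !mulr0 addr0 in ru rg.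
have [c [d [Ic Id /andP[cx xd]]]] := oitv_oo Ix; have cd := lt_trans cx xd.
have [M0 ugM] := solution_pair_bounded ug Ic Id cd.
have [iu ig] := ug; have [_ _ bu _ _] := iu; have [_ _ bg _ _] := ig.
have half0 : 0 < 2^-1 :> R by rewrite invr_gt0.
near x^'+ => t.
have xt : x < t by near: t; exact: nbhs_right_gt.
have td : t < d by near: t; exact: nbhs_right_lt.
have va : var (dmeas c d alpha) `]x, t[ <= 2^-1 by near: t; exact: var_oo_right.
have vb : var (dmeas c d beta) `]x, t[ <= 2^-1 by near: t; exact: var_oo_right.
have inD y : x < y < t -> c < y < d.
  by move=> /andP[xy yt]; rewrite (lt_trans cx)// (lt_trans yt).
apply/near_rightP; exists (t - x); first by rewrite subr_gt0.
rewrite subrKC; apply: (@contraction_eq0 _ [set y | x < y < t] u g M0) => [y|y|].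
- by move=> /inD /ugM[].
- by move=> /inD /ugM[].
- move=> M uM gM y xyt; split.
    by apply: (integral_of_half_right r01 iu Ic Id cx td _ va ru gM xyt); exact: bg.
  by apply: (integral_of_half_right r01 ig Ic Id cx td _ vb rg uM xyt); exact: bu.
Unshelve. all: by end_near. Qed.

Lemma solution_pair_zero_left u g x : pair u g -> oitv a b x ->
  u x = 0 -> g x = 0 -> \forall z \near x^'-, u z = 0 /\ g z = 0.
Proof.
move=> ug Ix u0 g0; have [lu _ lg _] := solution_pair_lims ug Ix.
rewrite u0 g0 !mulr0 subr0 in lu lg.
have [c [d [Ic Id /andP[cx xd]]]] := oitv_oo Ix; have cd := lt_trans cx xd.
have [M0 ugM] := solution_pair_bounded ug Ic Id cd.
have [iu ig] := ug; have [_ _ bu _ _] := iu; have [_ _ bg _ _] := ig.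
have half0 : 0 < 2^-1 :> R by rewrite invr_gt0.
near x^'- => t.
have tx : t < x by near: t; exact: nbhs_left_lt.
have ct : c < t by near: t; exact: nbhs_left_gt.
have va : var (dmeas c d alpha) `]t, x[ <= 2^-1 by near: t; exact: var_oo_left.
have vb : var (dmeas c d beta) `]t, x[ <= 2^-1 by near: t; exact: var_oo_left.
have inD y : t < y < x -> c < y < d.
  by move=> /andP[ty yx]; rewrite (lt_trans ct)// (lt_trans yx).
apply/near_leftP; exists (x - t); first by rewrite subr_gt0.
rewrite subKr; apply: (@contraction_eq0 _ [set y | t < y < x] u g M0) => [y|y|].
- by move=> /inD /ugM[].
- by move=> /inD /ugM[].
- move=> M uM gM y txy; split.
    by apply: (integral_of_half_left r01 iu Ic Id ct xd _ va lu gM txy); exact: bg.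
  by apply: (integral_of_half_left r01 ig Ic Id ct xd _ vb lg uM txy); exact: bu.
Unshelve. all: by end_near. Qed.

Lemma cvg_near_neq0 (F : set_system R) f l : Filter F ->
  f z @[z --> F] --> l -> l != 0 -> \forall z \near F, f z != 0.
Proof.
move=> FF fl l0; near=> z; rewrite -normr_gt0.
have : `|l - f z| < `|l|.
  by near: z; apply/(cvgrPdist_lt _ _).1 => //; rewrite normr_gt0.
have := ler_normD (l - f z) (f z); rewrite subrK; lra.
Unshelve. all: by end_near. Qed.

(** Zero data spread to both sides by the contraction. Nonzero data at a point give a nonzero
    one-sided limit of u or g on each side, by invertibility of the two matrices, so they spread as
    well. Hence [interval_constancy] applies with both functions equal to [Z]. *)
Lemma solution_pair_unique u g : pair u g ->
  forall x y, oitv a b x -> oitv a b y -> x < y ->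
  (u x = 0 /\ g x = 0) <-> (u y = 0 /\ g y = 0).
Proof.
move=> ug x y Ix Iy xy; have [[ru _ _ _ _] [rg _ _ _ _]] := ug.
have Iz z : x <= z <= y -> oitv a b z by exact: (oitv_between Ix Iy).
pose Z z := (u z == 0) && (g z == 0).
have ZP z : reflect (u z = 0 /\ g z = 0) (Z z).
  by apply: (iffP andP) => -[/eqP ? /eqP].
suff E : Z x = Z y by split=> /ZP; [rewrite E|rewrite -E] => /ZP.
apply: interval_constancy => // [z /andP[xz zy]|z /andP[xz zy]].
  have {}Iz : oitv a b z by apply: Iz; rewrite xz ltW.
  have [Zz|nZ] := boolP (Z z).
    have [u0 g0] := ZP _ Zz; apply: filterS (solution_pair_zero_right ug Iz u0 g0).
    by move=> w /ZP.
  have [u0|u0] := eqVneq (rlim u z) 0; last first.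
    apply: filterS (cvg_near_neq0 _ (ru _ Iz).2 u0) => w.
    by rewrite /Z => /negPf ->.
  have [g0|g0] := eqVneq (rlim g z) 0; last first.
    apply: filterS (cvg_near_neq0 _ (rg _ Iz).2 g0) => w.
    by rewrite /Z => /negPf ->; rewrite andbF.
  by have /ZP := solution_pair_rlim0 ug Iz u0 g0; rewrite (negPf nZ).
have {}Iz : oitv a b z by apply: Iz; rewrite zy ltW.
have [Zz|nZ] := boolP (Z z).
  have [u0 g0] := ZP _ Zz; apply: filterS (solution_pair_zero_left ug Iz u0 g0).
  by move=> w /ZP.
have [u0|u0] := eqVneq (llim u z) 0; last first.
  apply: filterS (cvg_near_neq0 _ (ru _ Iz).1 u0) => w.
  by rewrite /Z => /negPf ->.
have [g0|g0] := eqVneq (llim g z) 0; last first.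
  apply: filterS (cvg_near_neq0 _ (rg _ Iz).1 g0) => w.
  by rewrite /Z => /negPf ->; rewrite andbF.
by have /ZP := solution_pair_llim0 ug Iz u0 g0; rewrite (negPf nZ).
Qed.

End SolutionPairs.

(** * Signs of solutions and the Wronskian *)

Section Signs.
Context {R : realType}.
Implicit Types (x y z s t : R) (u g v h : R -> R).

Lemma gt0N x : x != 0 -> (0 < - x) = ~~ (0 < x).
Proof. by rewrite oppr_gt0; case: ltrgt0P. Qed.

Lemma gt0M x y : x != 0 -> y != 0 -> (0 < x * y) = ((0 < x) == (0 < y)).
Proof.
move=> x0 y0; case: (ltrgt0P x) x0 => // xs _.
  by rewrite pmulr_rgt0//; case: (0 < y).
by rewrite nmulr_rgt0// -oppr_gt0 gt0N//; case: (0 < y).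
Qed.

(* The sign of u immediately to the right (resp. left) of x, where g = du/dalpha
   decides when the one-sided limit of u vanishes. *)
Definition right_sign u g x :=
  if rlim u x == 0 then 0 < rlim g x else 0 < rlim u x.
Definition left_sign u g x :=
  if llim u x == 0 then llim g x < 0 else 0 < llim u x.

End Signs.

Section SignsOfSolutions.
Context {R : realType} (a b : \bar R) (r : R) (alpha beta : R -> R).
Implicit Types (x y z s t c d k l m e M : R) (f g h u v w : R -> R).
Hypothesis r01 : 0 <= r <= 1.
Hypothesis alpha_incr : forall x y, oitv a b x -> oitv a b y -> x < y ->
  alpha x < alpha y.
Hypothesis theta1r : forall x, oitv a b x -> theta alpha beta (1 - r) x != 0.
Hypothesis thetar : forall x, oitv a b x -> theta alpha beta r x != 0.

Let pair u g := solution_pair a b r alpha beta u g.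

(** If the right limit of u vanishes, g stays above half of its positive right limit, so u increases
    strictly from 0; the jumps of u are then nonnegative and keep the right limits positive too. *)
Lemma solution_pair_right_gt0 u g x : pair u g -> oitv a b x ->
  0 < rlim u x \/ rlim u x = 0 /\ 0 < rlim g x ->
  \forall z \near x^'+, 0 < llim u z /\ 0 < rlim u z.
Proof.
move=> [iu [rg _ bg _ _]] Ix; have [ru _ _ ju _] := iu; case=> [u0|[u0 g0]].
  have u20 : 0 < rlim u x / 2 by rewrite divr_gt0.
  have u2 : rlim u x / 2 < rlim u x by lra.
  apply: filterS (near_right_gt ru Ix u2) => z [lz _ rz].
  by split; [exact: lt_le_trans lz|exact: lt_le_trans rz].
have g20 : 0 < rlim g x / 2 by rewrite divr_gt0.
have g2 : rlim g x / 2 < rlim g x by lra.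
have /near_rightP[e e0 ge] := near_right_gt rg Ix g2.
near=> z.
have xz : x < z by near: z; exact: nbhs_right_gt.
have ze : z < x + e by near: z; apply: nbhs_right_lt; rewrite ltrDl.
have Iz : oitv a b z by near: z; have [] := oitv_near Ix.
have lz : 0 < llim u z.
  rewrite -u0; apply: (integral_alpha_gt0 alpha_incr g20 iu bg Ix Iz xz).
  by move=> y /andP[xy yz]; have [|] := ge y; rewrite ?xy ?(lt_trans yz).
split=> //; have := ju _ Iz; rewrite /jump.
have : 0 <= g z * jump alpha z.
  apply: mulr_ge0; last exact: (jump_alpha_ge0 alpha_incr Iz).
  by have [|_ + _] := ge z; rewrite ?xz ?ze//; apply: le_trans; exact: ltW.
by rewrite /jump; lra.
Unshelve. all: by end_near. Qed.

Lemma solution_pair_left_gt0 u g x : pair u g -> oitv a b x ->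
  0 < llim u x \/ llim u x = 0 /\ llim g x < 0 ->
  \forall z \near x^'-, 0 < llim u z /\ 0 < rlim u z.
Proof.
move=> ug Ix; have [[ru _ _ _ _] _] := ug; case=> [u0|[u0 g0]].
  have u20 : 0 < llim u x / 2 by rewrite divr_gt0.
  have u2 : llim u x / 2 < llim u x by lra.
  apply: filterS (near_left_gt ru Ix u2) => z [lz _ rz].
  by split; [exact: lt_le_trans lz|exact: lt_le_trans rz].
(* The negated solution, written as a linear combination so that [solution_pair_lin] supplies it. It
   increases up to 0 at x, hence is negative before x. *)
have [iw ih] := solution_pair_lin (-1) 0 ug ug.
have {ug} [_ [rg _ _ _ _]] := ug.
set w := (fun x => -1 * u x + 0 * u x) in iw ih.
set h := (fun x => -1 * g x + 0 * g x) in iw ih.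
have [rw _ _ jw _] := iw; have [rh _ bh _ _] := ih.
have wE z : oitv a b z -> llim w z = - llim u z /\ rlim w z = - rlim u z.
  by move=> Iz; have [-> ->] := (regulated_lin (-1) 0 ru ru).2 _ Iz; lra.
have hE z : oitv a b z -> llim h z = - llim g z.
  by move=> Iz; have [-> _] := (regulated_lin (-1) 0 rg rg).2 _ Iz; lra.
clearbody w h.
have h0 : 0 < llim h x by rewrite hE// oppr_gt0.
have h20 : 0 < llim h x / 2 by rewrite divr_gt0.
have h2 : llim h x / 2 < llim h x by lra.
have /near_leftP[e e0 he] := near_left_gt rh Ix h2.
near=> z.
have zx : z < x by near: z; exact: nbhs_left_lt.
have ze : x - e < z by near: z; apply: nbhs_left_gt; rewrite ltrBlDr ltrDl.
have Iz : oitv a b z by near: z; have [] := oitv_near Ix.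
have : rlim w z < llim w x.
  apply: (integral_alpha_gt0 alpha_incr h20 iw bh Iz Ix zx).
  by move=> y /andP[zy yx]; have [|] := he y; rewrite ?yx ?(lt_trans ze).
have := jw _ Iz; rewrite /jump.
have : 0 <= h z * jump alpha z.
  apply: mulr_ge0; last exact: (jump_alpha_ge0 alpha_incr Iz).
  by have [|_ + _] := he z; rewrite ?zx ?ze//; apply: le_trans; exact: ltW.
by rewrite (wE _ Ix).1 (wE _ Iz).1 (wE _ Iz).2 u0 /jump; split; lra.
Unshelve. all: by end_near. Qed.

(** * Strict one-sided signs of nontrivial solutions *)

Section Nontrivial.
Context (u g : R -> R).
Hypothesis ug : pair u g.
Hypothesis nz : forall x, oitv a b x -> ~ (u x = 0 /\ g x = 0).

(** When the boolean is false, the positive case applies to the negated solution. The remaining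
    possibility, u and g both with zero right limit, would give zero data at x because theta_r does
    not vanish. *)
Lemma near_right_sign x : oitv a b x -> \forall z \near x^'+,
  if right_sign u g x then 0 < llim u z /\ 0 < rlim u z
  else llim u z < 0 /\ rlim u z < 0.
Proof.
move=> Ix; have [S|nS] := boolP (right_sign u g x).
  apply: (solution_pair_right_gt0 ug Ix).
  by move: S; rewrite /right_sign; case: eqP => [? ?|_ ?]; [right|left].
have [[ru _ _ _ _] [rg _ _ _ _]] := ug.
have ug' := solution_pair_lin (-1) 0 ug ug.
have uE z : oitv a b z -> llim (fun x => -1 * u x + 0 * u x) z = - llim u z /\
    rlim (fun x => -1 * u x + 0 * u x) z = - rlim u z.
  by move=> Iz; have [-> ->] := (regulated_lin (-1) 0 ru ru).2 _ Iz; lra.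
have gE : rlim (fun x => -1 * g x + 0 * g x) x = - rlim g x.
  by have [_ ->] := (regulated_lin (-1) 0 rg rg).2 _ Ix; lra.
have := solution_pair_right_gt0 ug' Ix; rewrite (uE _ Ix).2 gE => H.
near=> z; have Iz : oitv a b z by near: z; have [] := oitv_near Ix.
rewrite -oppr_gt0 -[in X in _ /\ X]oppr_gt0 -(uE _ Iz).1 -(uE _ Iz).2.
near: z; apply: H; move: nS; rewrite /right_sign !oppr_gt0; case: eqP => [u0 g0|].
  right; rewrite u0 oppr0 lt_neqAle leNgt g0 andbT; split=> //.
  apply/eqP => g0'; apply: (nz Ix).
  exact: (solution_pair_rlim0 thetar ug Ix u0 g0').
by move=> /eqP u0; rewrite -leNgt => u_le; left; rewrite lt_neqAle u0.
Unshelve. all: by end_near. Qed.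

Lemma near_left_sign x : oitv a b x -> \forall z \near x^'-,
  if left_sign u g x then 0 < llim u z /\ 0 < rlim u z
  else llim u z < 0 /\ rlim u z < 0.
Proof.
move=> Ix; have [S|nS] := boolP (left_sign u g x).
  apply: (solution_pair_left_gt0 ug Ix).
  by move: S; rewrite /left_sign; case: eqP => [? ?|_ ?]; [right|left].
have [[ru _ _ _ _] [rg _ _ _ _]] := ug.
have ug' := solution_pair_lin (-1) 0 ug ug.
have uE z : oitv a b z -> llim (fun x => -1 * u x + 0 * u x) z = - llim u z /\
    rlim (fun x => -1 * u x + 0 * u x) z = - rlim u z.
  by move=> Iz; have [-> ->] := (regulated_lin (-1) 0 ru ru).2 _ Iz; lra.
have gE : llim (fun x => -1 * g x + 0 * g x) x = - llim g x.
  by have [-> _] := (regulated_lin (-1) 0 rg rg).2 _ Ix; lra.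
have := solution_pair_left_gt0 ug' Ix; rewrite (uE _ Ix).1 gE => H.
near=> z; have Iz : oitv a b z by near: z; have [] := oitv_near Ix.
rewrite -oppr_gt0 -[in X in _ /\ X]oppr_gt0 -(uE _ Iz).1 -(uE _ Iz).2.
near: z; apply: H; move: nS; rewrite /left_sign oppr_gt0 oppr_lt0; case: eqP => [u0|].
  rewrite -leNgt => g0; right; rewrite u0 oppr0; split=> //.
  rewrite lt_neqAle g0 andbT.
  apply/eqP => g0'; apply: (nz Ix).
  exact: (solution_pair_llim0 theta1r ug Ix u0 (esym g0')).
by move=> /eqP u0; rewrite -leNgt => u_le; left; rewrite lt_neqAle u0.
Unshelve. all: by end_near. Qed.

(** Serves twice: for u, which has no zero between s and t, and for v under the assumption that it
    does not change sign there. *)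
Lemma right_left_sign s t : oitv a b s -> oitv a b t -> s < t ->
  (forall x, s < x < t -> left_sign u g x = right_sign u g x) ->
  right_sign u g s = left_sign u g t.
Proof.
move=> Is It st eqs.
have H z (B : bool) : (if B then 0 < llim u z /\ 0 < rlim u z
    else llim u z < 0 /\ rlim u z < 0) ->
    left_sign u g z = B /\ right_sign u g z = B.
  rewrite /left_sign /right_sign; case: B => -[lz rz].
    by rewrite !gt_eqF.
  by rewrite !lt_eqF// !ltNge !ltW.
apply: interval_constancy st eqs _ _ => x /andP[sx xt].
  have Ix : oitv a b x by apply: (oitv_between Is It); rewrite sx ltW.
  by apply: filterS (near_right_sign Ix) => z /H[].
have Ix : oitv a b x by apply: (oitv_between Is It); rewrite xt ltW.
by apply: filterS (near_left_sign Ix) => z /H[].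
Qed.

Lemma changes_sign_atP x : oitv a b x -> left_sign u g x != right_sign u g x ->
  changes_sign_at a b u x.
Proof.
move=> Ix neq; split=> //.
have [In Ip] := oitv_near Ix.
have /near_rightP[e1 e10 H1] := near_right_sign Ix.
have /near_leftP[e2 e20 H2] := near_left_sign Ix.
have [c [d [Ic Id /andP[cx xd]]]] := oitv_oo Ix.
pose e := Num.min (Num.min e1 e2) (Num.min (x - c) (d - x)).
have e0 : 0 < e by rewrite !lt_min e10 e20 !subr_gt0 cx xd.
have : e <= e by [].
rewrite {2}/e !le_min => /andP[/andP[ee1 ee2] /andP[ec ed]].
exists e; split=> // [y|].
  rewrite /= in_itv/= => /andP[y1 y2].
  by apply: (oitv_between Ic Id); apply/andP; split; lra.
have {}H1 y : x < y < x + e -> _ := fun xy => H1 y (ltac:(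
  by case/andP: xy => xy ye; rewrite xy (lt_le_trans ye)// lerD2l)).
have {}H2 y : x - e < y < x -> _ := fun xy => H2 y (ltac:(
  by case/andP: xy => ye yx; rewrite yx andbT; lra)).
by case: (left_sign u g x) (right_sign u g x) neq H1 H2 => -[]// _ H1 H2;
  [right|left]; split=> y /[dup] ? ; [move=> /H2[]|move=> /H1[]|
   move=> /H2[]|move=> /H1[]].
Qed.

End Nontrivial.

(** * The Wronskian: jumps, sign, and its value at the zeros of u *)

Section Wronskian.
Context (u g v h : R -> R).
Hypotheses (ug : pair u g) (vh : pair v h).

Let W x := u x * h x - v x * g x.
Let Wl x := llim u x * llim h x - llim v x * llim g x.
Let Wr x := rlim u x * rlim h x - rlim v x * rlim g x.

(** W is the determinant of the data of u and v, so it is multiplied by the determinants of the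
    matrices in [solution_pair_lims]. *)
Lemma wronskian_lims x : oitv a b x ->
  Wl x = theta alpha beta (1 - r) x * W x /\ Wr x = theta alpha beta r x * W x.
Proof.
move=> Ix; rewrite /Wl /Wr /W /theta.
have [-> -> -> ->] := solution_pair_lims ug Ix.
have [-> -> -> ->] := solution_pair_lims vh Ix.
by split; ring.
Qed.

(** If W x = 0, the combination with coefficients (v x, - u x) has zero data at x, so u x = v x = 0.
    Then the one with (h x, - g x) does, so g x = h x = 0. Finally (1, 0) does, against
    independence. This order avoids a case distinction on which entry is nonzero. *)
Lemma wronskian_neq0 x : lin_indep a b u v -> oitv a b x -> W x != 0.
Proof.
move=> indep Ix; apply/eqP => W0.
have dep k l : k * u x + l * v x = 0 -> k * g x + l * h x = 0 -> k = 0 /\ l = 0.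
  move=> eu eg; apply: indep => y Iy.
  have kl := solution_pair_lin k l ug vh.
  have U := solution_pair_unique r01 theta1r thetar kl.
  have [xy|yx|<-//] := ltgtP x y; first by have [] := (U _ _ Ix Iy xy).1.
  by have [] := (U _ _ Iy Ix yx).2.
have [v0 /eqP] : v x = 0 /\ - u x = 0.
  by apply: dep; [ring|rewrite -[RHS]oppr0 -W0 /W; ring].
rewrite oppr_eq0 => /eqP u0.
have [h0 /eqP] : h x = 0 /\ - g x = 0.
  by apply: dep; [rewrite u0 v0; ring|ring].
rewrite oppr_eq0 => /eqP g0.
have [] : 1 = 0 :> R /\ 0 = 0 :> R by apply: dep; rewrite ?u0 ?v0 ?g0 ?h0; ring.
by move/eqP; rewrite oner_eq0.
Qed.

Hypothesis W_neq0 : forall x, oitv a b x -> W x != 0.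

Lemma Wl_neq0 x : oitv a b x -> Wl x != 0.
Proof. by move=> Ix; rewrite (wronskian_lims Ix).1 mulf_neq0 ?theta1r ?W_neq0. Qed.

Lemma Wr_neq0 x : oitv a b x -> Wr x != 0.
Proof. by move=> Ix; rewrite (wronskian_lims Ix).2 mulf_neq0 ?thetar ?W_neq0. Qed.

Lemma wronskian_sign s t : oitv a b s -> oitv a b t -> s < t ->
  (forall x, s < x < t -> 0 < theta_ratio alpha beta r x) ->
  (0 < Wr s) = (0 < Wl t).
Proof.
move=> Is It st pos.
have [[ru _ _ _ _] [rg _ _ _ _]] := ug; have [[rv _ _ _ _] [rh _ _ _ _]] := vh.
have [ruh Euh] := regulatedM ru rh; have [rvg Evg] := regulatedM rv rg.
have [rW EW] := regulated_lin 1 (-1) ruh rvg.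
set w := (fun x => _) in rW EW.
have wE x : oitv a b x -> llim w x = Wl x /\ rlim w x = Wr x.
  move=> Ix; rewrite (EW _ Ix).1 (EW _ Ix).2 (Euh _ Ix).1 (Euh _ Ix).2.
  by rewrite (Evg _ Ix).1 (Evg _ Ix).2 !mul1r !mulN1r.
apply: (@interval_constancy _ _ (fun x => 0 < Wl x) (fun x => 0 < Wr x) _ _ st)
  => x /andP[sx xt].
- have Ix : oitv a b x by apply: (oitv_between Is It); rewrite !ltW.
  have [-> ->] := wronskian_lims Ix; rewrite !gt0M ?theta1r ?thetar ?W_neq0//.
  have := pos x; rewrite sx xt /theta_ratio gt0M ?invr_eq0 ?theta1r ?thetar//.
  by rewrite invr_gt0 => /(_ isT) /eqP ->.
- have Ix : oitv a b x by apply: (oitv_between Is It); rewrite sx ltW.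
  have [_ Er] := wE _ Ix; have := Wr_neq0 Ix.
  rewrite neq_lt -Er => /orP[W0|W0].
    (* Nearby values are controlled by weak inequalities only; half the limit as threshold leaves a
       strict sign. *)
    have W2 : rlim w x < rlim w x / 2 by lra.
    near=> z.
    have Iz : oitv a b z by near: z; have [] := oitv_near Ix.
    rewrite -(wE _ Iz).1 !ltNge (ltW W0); congr negb.
    have [lz _ _] : [/\ llim w z <= rlim w x / 2, w z <= rlim w x / 2 &
      rlim w z <= rlim w x / 2] by near: z; exact: near_right_lt rW Ix W2.
    by apply/ltW/(le_lt_trans lz); lra.
  have W2 : rlim w x / 2 < rlim w x by lra.
  near=> z.
  have Iz : oitv a b z by near: z; have [] := oitv_near Ix.
  rewrite -(wE _ Iz).1 W0.
  have [lz _ _] : [/\ rlim w x / 2 <= llim w z, rlim w x / 2 <= w z &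
    rlim w x / 2 <= rlim w z] by near: z; exact: near_right_gt rW Ix W2.
  by apply/(lt_le_trans _ lz); lra.
- have Ix : oitv a b x by apply: (oitv_between Is It); rewrite xt ltW.
  have [Er _] := wE _ Ix; have := Wl_neq0 Ix.
  rewrite neq_lt -Er => /orP[W0|W0].
    have W2 : llim w x < llim w x / 2 by lra.
    near=> z.
    have Iz : oitv a b z by near: z; have [] := oitv_near Ix.
    rewrite -(wE _ Iz).2 !ltNge (ltW W0); congr negb.
    have [_ _ lz] : [/\ llim w z <= llim w x / 2, w z <= llim w x / 2 &
      rlim w z <= llim w x / 2] by near: z; exact: near_left_lt rW Ix W2.
    by apply/ltW/(le_lt_trans lz); lra.
  have W2 : llim w x / 2 < llim w x by lra.
  near=> z.
  have Iz : oitv a b z by near: z; have [] := oitv_near Ix.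
  rewrite -(wE _ Iz).2 W0.
  have [_ _ lz] : [/\ llim w x / 2 <= llim w z, llim w x / 2 <= w z &
    llim w x / 2 <= rlim w z] by near: z; exact: near_left_gt rW Ix W2.
  by apply/(lt_le_trans _ lz); lra.
Unshelve. all: by end_near. Qed.

Lemma gt0_wronskian_theta x : oitv a b x ->
  (0 < Wl x) = ((0 < theta alpha beta (1 - r) x) == (0 < W x)) /\
  (0 < Wr x) = ((0 < theta alpha beta r x) == (0 < W x)).
Proof.
move=> Ix; have [-> ->] := wronskian_lims Ix.
by rewrite !gt0M ?theta1r ?thetar ?W_neq0.
Qed.

(** The form the Wronskian takes at a zero of u: q is a one-sided limit of v, p a value or one-sided
    limit of g, and w is W or a one-sided limit of it. *)
Lemma gt0NM (p q w : R) : p != 0 -> w = - (q * p) -> w != 0 ->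
  (0 < q) = (0 < w) (+) (0 < p).
Proof.
move=> p0 -> ; rewrite oppr_eq0 mulf_eq0 (negPf p0) orbF => q0.
by rewrite gt0N ?mulf_neq0// gt0M//; case: (0 < p); case: (0 < q).
Qed.

Lemma right_sign_rlim0 s : oitv a b s -> rlim u s = 0 ->
  right_sign v h s = (0 < Wr s) (+) right_sign u g s.
Proof.
move=> Is u0; have := Wr_neq0 Is; rewrite /right_sign /Wr u0 eqxx mul0r sub0r.
move=> W0; have := W0; rewrite oppr_eq0 mulf_eq0 negb_or => /andP[v0 g0].
by rewrite (negPf v0); apply: gt0NM.
Qed.

Lemma left_sign_llim0 t : oitv a b t -> llim u t = 0 ->
  left_sign v h t = ~~ ((0 < Wl t) (+) left_sign u g t).
Proof.
move=> It u0; have := Wl_neq0 It; rewrite /left_sign /Wl u0 eqxx mul0r sub0r.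
move=> W0; have := W0; rewrite oppr_eq0 mulf_eq0 negb_or => /andP[v0 g0].
rewrite (negPf v0) -(oppr_gt0 (llim g t)) (gt0N g0) addbN negbK.
exact: gt0NM.
Qed.

(** From u^-(s) = 0 follow u(s) = (1 - r) jump(alpha) g(s) and u^+(s) = jump(alpha) g(s). So g(s)
    gives the sign of u after s, also when alpha does not jump, since then g^+(s) = g(s); and W(s) =
    - v^-(s) g(s). *)
Lemma left_sign_right_sign s : oitv a b s -> llim u s = 0 ->
  left_sign v h s = (0 < W s) (+) right_sign u g s.
Proof.
move=> Is u0; have := Wl_neq0 Is; rewrite /Wl u0 mul0r sub0r oppr_eq0.
rewrite mulf_eq0 negb_or => /andP[v0 _].
have [lu ru _ rg] := solution_pair_lims ug Is.
have [lv _ _ _] := solution_pair_lims vh Is.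
move: lu; rewrite u0 => /esym/eqP; rewrite subr_eq0 => /eqP us.
have Wg : W s = - (llim v s * g s) by rewrite /W lv us; ring.
have g0 : g s != 0.
  by apply: contraNneq (W_neq0 Is) => g0; rewrite Wg g0 mulr0 oppr0.
have -> : right_sign u g s = (0 < g s).
  have ruE : rlim u s = jump alpha s * g s by rewrite ru us; ring.
  rewrite /right_sign ruE mulf_eq0 (negPf g0) orbF; case: eqP => [A0|/eqP A0].
    by rewrite rg us A0 !(mulr0, mul0r) addr0.
  by rewrite pmulr_rgt0// lt_neqAle eq_sym A0 (jump_alpha_ge0 alpha_incr Is).
by rewrite /left_sign (negPf v0); apply: gt0NM (W_neq0 Is).
Qed.

(** The mirror image has a negation: u^-(t) = - jump(alpha) g(t), so before t the sign of u is
    opposite to that of g(t). *)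
Lemma right_sign_left_sign t : oitv a b t -> rlim u t = 0 ->
  right_sign v h t = ~~ ((0 < W t) (+) left_sign u g t).
Proof.
move=> It u0; have := Wr_neq0 It; rewrite /Wr u0 mul0r sub0r oppr_eq0.
rewrite mulf_eq0 negb_or => /andP[v0 _].
have [lu ru lg _] := solution_pair_lims ug It.
have [_ rv _ _] := solution_pair_lims vh It.
move: ru; rewrite u0 => /esym/eqP; rewrite addr_eq0 => /eqP ut.
have Wg : W t = - (rlim v t * g t) by rewrite /W rv ut; ring.
have g0 : g t != 0.
  by apply: contraNneq (W_neq0 It) => g0; rewrite Wg g0 mulr0 oppr0.
have -> : left_sign u g t = ~~ (0 < g t).
  have luE : llim u t = jump alpha t * - g t by rewrite lu ut; ring.
  rewrite /left_sign luE mulf_eq0 oppr_eq0 (negPf g0) orbF -gt0N//.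
  case: eqP => [A0|/eqP A0].
    by rewrite lg ut A0 !(mulr0, mul0r) oppr0 mulr0 subr0 oppr_gt0.
  by rewrite pmulr_rgt0// lt_neqAle eq_sym A0 (jump_alpha_ge0 alpha_incr It).
rewrite /right_sign (negPf v0) addbN negbK.
exact: gt0NM (W_neq0 It).
Qed.

End Wronskian.

End SignsOfSolutions.

(** * Sign changes of v between consecutive zeros of u *)

Theorem theorem5p3 (R : realType) (a b : \bar R) (r : R)
    (alpha beta u v : R -> R) (s t : R)
    (hab : (a < b)%E)
    (hr : 0 <= r <= 1)
    (halpha : forall x y, oitv a b x -> oitv a b y -> x < y ->
       alpha x < alpha y)
    (hbeta : BVloc a b beta)
    (htheta1r : forall x, oitv a b x -> theta alpha beta (1 - r) x != 0)
    (hthetar : forall x, oitv a b x -> theta alpha beta r x != 0)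
    (hu : balanced_solution r a b alpha beta u)
    (hv : balanced_solution r a b alpha beta v)
    (huv : lin_indep a b u v)
    (hst : consecutive_zeros a b u s t)
    (hpos : forall x, s < x < t -> 0 < theta_ratio alpha beta r x) :
  [/\ rlim u s = 0 /\ llim u t = 0 ->
        changes_sign_in a b v `]s, t[,
      llim u s = 0 /\ llim u t = 0 /\ 0 < theta alpha beta r s ->
        changes_sign_in a b v `[s, t[,
      rlim u s = 0 /\ rlim u t = 0 /\ 0 < theta alpha beta (1 - r) t ->
        changes_sign_in a b v `]s, t] &
      llim u s = 0 /\ rlim u t = 0 /\
        0 < theta alpha beta r s * theta alpha beta (1 - r) t ->
        changes_sign_in a b v `[s, t]].
Proof.
have [g ug] := balanced_solution_pair halpha hbeta hu.
have [h vh] := balanced_solution_pair halpha hbeta hv.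
have [[Is _] [It _] st nozero] := hst.
have Ist x : s <= x <= t -> oitv a b x by exact: (oitv_between Is It).
have Ws x : oitv a b x -> u x * h x - v x * g x != 0.
  by move=> Ix; exact: (wronskian_neq0 hr htheta1r hthetar ug vh huv Ix).
have nzu x : oitv a b x -> ~ (u x = 0 /\ g x = 0).
  by move=> /Ws /eqP W0 [u0 g0]; apply: W0; rewrite u0 g0 mul0r mulr0 subr0.
have nzv x : oitv a b x -> ~ (v x = 0 /\ h x = 0).
  by move=> /Ws /eqP W0 [v0 h0]; apply: W0; rewrite v0 h0 mul0r mulr0 subr0.
have signu : right_sign u g s = left_sign u g t.
  apply: (right_left_sign halpha htheta1r hthetar ug nzu Is It st) => x sxt.
  have Ix : oitv a b x by apply: Ist; case/andP: sxt => ? ?; rewrite !ltW.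
  have : 0 < llim u x * rlim u x.
    rewrite ltNge; apply/negP => ux0.
    by have : set0 x by rewrite -nozero; split=> //=; rewrite in_itv.
  move=> lr0; have : llim u x * rlim u x != 0 by rewrite gt_eqF.
  rewrite mulf_eq0 negb_or => /andP[l0 r0].
  move: lr0; rewrite gt0M// /left_sign /right_sign (negPf l0) (negPf r0).
  by move=> /eqP.
have signW := wronskian_sign htheta1r hthetar ug vh Ws Is It st hpos.
have [Wls Wrs] := gt0_wronskian_theta htheta1r hthetar ug vh Ws Is.
have [Wlt Wrt] := gt0_wronskian_theta htheta1r hthetar ug vh Ws It.
have change x : oitv a b x -> ~ changes_sign_at a b v x ->
    left_sign v h x = right_sign v h x.
  move=> Ix; apply: contra_notP => /eqP.
  exact: (changes_sign_atP halpha htheta1r hthetar vh nzv Ix).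
(* All cases go by contradiction: without a sign change the sign of v is constant from s to t, and
   an end point included in D also passes it across to its other side. *)
have key (D : set R) : `]s, t[ `<=` D -> ~ changes_sign_in a b v D ->
    right_sign v h s = left_sign v h t /\
    (forall x, D x -> oitv a b x -> left_sign v h x = right_sign v h x).
  move=> sD nD; split=> [|x Dx Ix].
    apply: (right_left_sign halpha htheta1r hthetar vh nzv Is It st) => x sxt.
    have Ix : oitv a b x by apply: Ist; case/andP: sxt => ? ?; rewrite !ltW.
    apply: change => // cx; apply: nD; exists x => //.
    by apply: sD; rewrite /= in_itv.
  by apply: change => // cx; apply: nD; exists x.
(* The boolean covers both [s, t[ and [s, t]; likewise ]s, t] and [s, t] in [t_in]. *)
have s_in (q : bool) : s \in Interval (BLeft s) (BSide q t).
  by rewrite in_itv/= lexx; case: q; rewrite /= ?ltW.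
have t_in (p : bool) : t \in Interval (BSide p s) (BRight t).
  by rewrite in_itv/= lexx andbT; case: p; rewrite /= ?ltW.
(* In each case the absence of a sign change equates two booleans that the Wronskian formulas at s
   and t show to be negations of each other. *)
split.
- move=> [us ut]; apply: contrapT => /key[]// + _.
  rewrite (right_sign_rlim0 hthetar ug vh Ws Is us).
  rewrite (left_sign_llim0 htheta1r ug vh Ws It ut) signu signW.
  by case: (_ (+) _).
- move=> [us [ut th]]; apply: contrapT => /key[]; first exact: subset_itv_oo_co.
  move=> + /(_ s (s_in _) Is) eqs; rewrite -eqs.
  rewrite (left_sign_right_sign halpha htheta1r ug vh Ws Is us).
  rewrite (left_sign_llim0 htheta1r ug vh Ws It ut) -signW Wrs th signu.
  by case: (0 < _); case: left_sign.
- move=> [us [ut th]]; apply: contrapT => /key[]; first exact: subset_itv_oo_oc.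
  move=> + /(_ t (t_in _) It) eqt; rewrite eqt.
  rewrite (right_sign_rlim0 hthetar ug vh Ws Is us).
  rewrite (right_sign_left_sign halpha hthetar ug vh Ws It ut) signW Wlt th signu.
  by case: (0 < _); case: left_sign.
- move=> [us [ut th]]; apply: contrapT => /key[]; first exact: subset_itv_oo_cc.
  move=> + eqv; rewrite -(eqv s (s_in _) Is) (eqv t (t_in _) It).
  rewrite (left_sign_right_sign halpha htheta1r ug vh Ws Is us).
  rewrite (right_sign_left_sign halpha hthetar ug vh Ws It ut) signu.
  (* A positive product only says that theta_r(s) and theta_{1-r}(t) have the same sign. That
     suffices: W(s) and W(t) then have the same sign, even if both factors are negative. *)
  move: th signW; rewrite gt0M ?hthetar ?htheta1r// Wrs Wlt => /eqP ->.
  by case: (0 < theta _ _ _ _); case: (0 < _ s * _ - _);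
    case: (0 < _ t * _ - _); case: left_sign.
Qed.
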